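(* Let $\mathcal X$ be a Polish space, $\bar\mu\in\mathcal P(\mathcal X)$ and $\tau\colon\mathcal X\to[0,+\infty]$ measurable, such that $\bar\mu(\{\tau=0\})=\bar\mu(\{\tau=+\infty\})=0$, $\bar\mu(\{\xi<+\infty\})=0$ and $\xi^\infty=+\infty$. Define $I\colon\mathcal P(\mathcal X)\to[0,+\infty]$ by $$I(\nu)=\begin{cases}\nu_a(1/\tau)\,\mathbf H(\bar\nu_a|\bar\mu)+\nu_s(\xi) & \text{if }\nu_a(1/\tau)<+\infty,\\ +\infty&\text{otherwise,}\end{cases}$$ where $\nu_a(1/\tau)\,\mathbf H(\bar\nu_a|\bar\mu):=0$ whenever $\nu_a(1/\tau)=0$. Then $I$ is a good and convex functional on $\mathcal P(\mathcal X)$.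
   Context: Fix a complete metric on $\mathcal X$ inducing its topology; $B_\delta(x)$ is the ball of radius $\delta$ centered at $x$. $\mathcal P(\mathcal X)$ is the set of Borel probability measures on $\mathcal X$ with the narrow (weak) topology, i.e. the weakest topology making $\mu\mapsto\mu(f)$ continuous for all bounded continuous $f$; $\mu(f):=\int f\,d\mu$. Define $\xi\colon\mathcal X\to[0,+\infty]$ and $\xi^\infty\in[0,+\infty]$ by $$\xi(x)=\sup_{\delta>0}\sup\{c\ge0:\ \bar\mu(e^{c\tau}\mathbf 1_{B_\delta(x)})<+\infty\},\qquad \xi^\infty=\sup_{K\subset\mathcal X,\ K\text{ compact}}\sup\{c\ge0:\ \bar\mu(e^{c\tau}\mathbf 1_{K^c})<+\infty\}.$$ For $\nu\in\mathcal P(\mathcal X)$, $\nu_a$ and $\nu_s$ are the absolutely continuous and singular parts of $\nu$ with respect to $\bar\mu$. If $\nu_a(1/\tau)\in\,]0,+\infty[$, $\bar\nu_a\in\mathcal P(\mathcal X)$ is the probability measure $\bar\nu_a(dx)=\frac{\frac1{\tau(x)}\nu_a(dx)}{\nu_a(1/\tau)}$. $\mathbf H(\nu|\mu)$ is the relative entropy: $\mathbf H(\nu|\mu)=\int h(\frac{d\nu}{d\mu})\,d\mu$ with $h(\varrho)=\varrho(\log\varrho-1)+1$ if $\nu\ll\mu$, and $+\infty$ otherwise. A functional $I\colon\mathcal Y\to[0,+\infty]$ on a Polish space $\mathcal Y$ is good if $\{y: I(y)\le M\}$ is compact for all $M>0$ and $I\not\equiv+\infty$. *)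

(* Defs.v *)
From HB Require Import structures.
From mathcomp Require Import all_boot all_order all_algebra.
From mathcomp Require Import all_classical all_reals all_analysis.
From mathcomp Require Import measurable_realfun.

Set Implicit Arguments.
Unset Strict Implicit.
Unset Printing Implicit Defensive.

Import Order.TTheory GRing.Theory Num.Def Num.Theory.
Import numFieldNormedType.Exports.

Local Open Scope classical_set_scope.
Local Open Scope ring_scope.

HB.mixin Record isSeparable (T : Type) & Topological T := {
  separableT : exists2 D : set T, countable D & dense D
}.

(* A Polish space together with a fixed complete metric inducing its topology.
   The base point is required by the library's measurable types; it excludes
   only the empty space, which carries no probability measure. *)
#[short(type="polishMetricType")]
HB.structure Definition PolishMetric (R : realType) :=
  {T of Metric R T & Complete T & isSeparable T}.

Notation borel X := (g_sigma_algebraType (@open X)).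

(* The narrow topology. Two elements of [narrow X] that agree on Borel sets but
   differ, as functions, on non-measurable sets are topologically
   indistinguishable. *)
Section narrow.
Context {R : realType} (X : polishMetricType R).

Definition narrow : Type := probability (borel X) R.

HB.instance Definition _ := Choice.on narrow.

Definition bounded_continuous : Type :=
  {f : X -> R | continuous f /\ exists M : R, forall x, `|f x| <= M}.

Definition narrow_eval (f : bounded_continuous) (nu : narrow) : R :=
  Rintegral (nu : probability (borel X) R) setT (sval f).

HB.instance Definition _ := Topological.copy narrow
  (sup_topology (fun f : bounded_continuous =>
     Topological.class (initial_topology (narrow_eval f)))).

End narrow.

Local Open Scope ereal_scope.

Section lebesgue_decomposition.
Context d (T : measurableType d) (R : realType).

Definition mutually_singular (nu mu : {measure set T -> \bar R}) : Prop :=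
  exists N, [/\ measurable N, mu N = 0 & nu (~` N) = 0].

Definition is_lebesgue_decomposition (nu mu : {measure set T -> \bar R})
    (nuas : {measure set T -> \bar R} * {measure set T -> \bar R}) : Prop :=
  [/\ nuas.1 `<< mu, mutually_singular nuas.2 mu &
      forall A, measurable A -> nu A = nuas.1 A + nuas.2 A].

Lemma lebesgue_decomposition_exists (nu : probability T R)
    (mu : {measure set T -> \bar R}) :
  exists nuas, is_lebesgue_decomposition nu mu nuas.
Proof.
pose S := [set nu N | N in [set N | measurable N /\ mu N = 0]].
have Sfin : ereal_sup S \is a fin_num.
  rewrite ge0_fin_numE.
    apply: (@le_lt_trans _ _ 1); last exact: ltry.
    by apply: ge_ereal_sup => _ [N [mN _] <-]; exact: probability_le1.
  by apply: ereal_sup_ubound; exists set0 => //; rewrite ?measure0.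
have /choice[F HF] : forall n : nat, exists N, [/\ measurable N, mu N = 0 &
    ereal_sup S - (n.+1%:R^-1)%:E < nu N].
  move=> n; have e0 : (0 < n.+1%:R^-1 :> R)%R by rewrite invr_gt0 ltr0n.
  have [_ [N [mN muN] <-] ltN] := ub_ereal_sup_adherent e0 Sfin.
  by exists N.
have mF n : measurable (F n) by have [] := HF n.
pose N := \bigcup_n F n.
have mN : measurable N by exact: bigcupT_measurable.
have muN : mu N = 0.
  apply/(negligibleP mu mN); apply: negligible_bigcup => n.
  by apply/negligibleP; [exact: mF|have [] := HF n].
have nuN : ereal_sup S <= nu N.
  apply/lee_addgt0Pr => e e0.
  have [n ne] : exists n : nat, (n.+1%:R^-1 < e)%R.
    have [n _ nP] := near_infty_natSinv_lt (PosNum e0).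
    by exists n; have := nP n (leqnn n).
  have [_ _ Fn] := HF n.
  rewrite -leeBlDr//; apply: (@le_trans _ _ (nu (F n))); last first.
    by apply: le_measure; rewrite ?inE//; exact: bigcup_sup.
  apply: ltW; apply: le_lt_trans Fn.
  by rewrite leeB// lee_fin ltW.
have mCN : measurable (~` N) by exact: measurableC.
exists ([the measure T R of mrestr nu mCN], [the measure T R of mrestr nu mN]).
split => /=.
- apply/null_content_dominatesP => A mA muA; rewrite /mrestr.
  have mD : measurable (A `&` ~` N) by exact: measurableI.
  have : nu ((A `&` ~` N) `|` N) <= nu N.
    apply: le_trans nuN; apply: ereal_sup_ubound; exists (A `&` ~` N `|` N) => //.
    split; first exact: measurableU.
    rewrite measureU0//; apply/eqP; rewrite eq_le measure_ge0 andbT -muA.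
    by apply: le_measure; rewrite ?inE.
  rewrite measureU//; last by apply/seteqP; split => x //= -[[]].
  rewrite -leeBrDr ?fin_num_measure// subee ?fin_num_measure// => le0.
  by apply/eqP; rewrite eq_le le0 measure_ge0.
- exists N; split => //; change (nu (~` N `&` N) = 0).
  by rewrite setICl measure0.
- move=> A mA; rewrite /mrestr addeC -measureU; [|exact: measurableI..|].
    by rewrite -setIUr setUv setIT.
  by apply/seteqP; split => x //= -[[_ ?] []].
Qed.

Definition lebesgue_decomposition (nu : probability T R)
    (mu : {measure set T -> \bar R}) :=
  sval (cid (lebesgue_decomposition_exists nu mu)).

Definition ac_part nu mu : {measure set T -> \bar R} :=
  (lebesgue_decomposition nu mu).1.

Definition singular_part nu mu : {measure set T -> \bar R} :=
  (lebesgue_decomposition nu mu).2.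

End lebesgue_decomposition.

Section density.
Context d (T : measurableType d) (R : realType).
Variables (nu : {measure set T -> \bar R}) (f : T -> \bar R).

Definition mdensity of measurable_fun setT f & (forall x, 0 <= f x) :=
  fun A : set T => \int[nu]_(x in A) f x.

Hypotheses (mf : measurable_fun setT f) (f0 : forall x, 0 <= f x).

Local Notation m := (mdensity mf f0).

Let m0 : m set0 = 0. Proof. exact: integral_set0. Qed.

Let m_ge0 A : 0 <= m A. Proof. exact: integral_ge0. Qed.

Let m_sigma_additive : semi_sigma_additive m.
Proof. exact: semi_sigma_additive_nng_induced. Qed.

HB.instance Definition _ := isMeasure.Build _ _ _ m m0 m_ge0 m_sigma_additive.

End density.

Section relative_entropy.
Context d (T : measurableType d) (R : realType).

(* [ln 0 = 0] in the library, so [entropy_fun 0 = 1] as usual. *)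
Definition entropy_fun (r : R) : R := (r * (ln r - 1) + 1)%R.

Definition relative_entropy (nu mu : probability T R) : \bar R :=
  if `[< nu `<< mu >] then
    \int[mu]_x (entropy_fun
      (fine (Radon_Nikodym (charge_of_finite_measure nu) mu x)))%:E
  else +oo.

End relative_entropy.

Section mixture.
Context d (T : measurableType d) (R : realType).
Variables (t : {i01 R}) (nu1 nu2 : probability T R).

Definition mixture := fun A : set T =>
  t%:num%:E * nu1 A + (1 - t%:num)%:E * nu2 A.

Let t0 : 0 <= t%:num%:E. Proof. by rewrite lee_fin. Qed.

Let t1 : 0 <= (1 - t%:num)%:E. Proof. by rewrite lee_fin subr_ge0. Qed.

Let mixture0 : mixture set0 = 0.
Proof. by rewrite /mixture !measure0 !mule0 adde0. Qed.

Let mixture_ge0 A : 0 <= mixture A.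
Proof. by rewrite /mixture adde_ge0// mule_ge0. Qed.

Let mixture_sigma_additive : semi_sigma_additive mixture.
Proof.
have -> : mixture = measure_add (mscale (NngNum t0) nu1) (mscale (NngNum t1) nu2).
  by apply/funext => A; rewrite measure_addE.
exact: measure_semi_sigma_additive.
Qed.

HB.instance Definition _ := isMeasure.Build _ _ _ mixture
  mixture0 mixture_ge0 mixture_sigma_additive.

Let mixtureT : mixture setT = 1.
Proof. by rewrite /mixture !probability_setT !mule1 -EFinD addrC subrK. Qed.

HB.instance Definition _ := Measure_isProbability.Build _ _ _ mixture mixtureT.

End mixture.

Definition good_functional (R : realType) (Y : topologicalType)
    (I : Y -> \bar R) : Prop :=
  [/\ forall y, 0 <= I y,
      forall M : R, (0 < M)%R -> compact [set y | I y <= M%:E] &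
      ~ (forall y, I y = +oo)].

Definition convex_functional d (T : measurableType d) (R : realType)
    (I : probability T R -> \bar R) : Prop :=
  forall (nu1 nu2 : probability T R) (t : {i01 R}),
    I (mixture t nu1 nu2) <= t%:num%:E * I nu1 + (1 - t%:num)%:E * I nu2.

Section functional.
Context (R : realType) (X : polishMetricType R).
Variables (mu : probability (borel X) R) (tau : X -> \bar R).

Definition exp_rate (A : set X) : \bar R :=
  ereal_sup [set c%:E | c in
    [set c : R | (0 <= c)%R /\ \int[mu]_(y in A) expeR (c%:E * tau y) < +oo]].

Definition xi (x : X) : \bar R :=
  ereal_sup [set exp_rate (ball x delta) |
    delta in [set delta : R | (0 < delta)%R]].

Definition xi_infty : \bar R :=
  ereal_sup [set exp_rate (~` K) | K in [set K : set X | compact K]].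

(* [inve] satisfies 0^-1 = +oo and +oo^-1 = 0. *)
Definition inv_tau : borel X -> \bar R := fun x => (tau x)^-1.

Hypotheses (mtau : measurable_fun (setT : set (borel X)) tau)
           (tau0 : forall x, 0 <= tau x).

Lemma inv_tau_ge0 x : 0 <= inv_tau x.
Proof. by rewrite /inv_tau inve_ge0. Qed.

Lemma measurable_inv_tau : measurable_fun setT inv_tau.
Proof.
have -> : inv_tau = fun x => if tau x == 0 then +oo else
    if tau x == +oo then 0 else ((fine (tau x)) `^ (-1))%:E.
  apply/funext => x; have := tau0 x; rewrite /inv_tau.
  case: (tau x) => [r|//|//]; rewrite lee_fin => r0.
  by rewrite inver eqe powR_inv1.
apply: measurable_fun_ifT => //; first exact: measurable_fun_eqe.
apply: measurable_fun_ifT => //; first exact: measurable_fun_eqe.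
apply/measurable_EFinP; apply: (measurableT_comp (measurable_powR _)).
exact: measurableT_comp mtau.
Qed.

(* [mnormalize] returns its second argument when the total mass is 0 or +oo; in
   the definition of [rate_functional] below this default is never used. *)
Definition ac_tilt (nu : probability (borel X) R) : probability (borel X) R :=
  mnormalize (mdensity (ac_part nu mu) measurable_inv_tau inv_tau_ge0) mu.

Definition rate_functional (nu : narrow X) : \bar R :=
  let mass := \int[ac_part nu mu]_x inv_tau x in
  if mass < +oo then
    (if mass == 0 then 0 else mass * relative_entropy (ac_tilt nu) mu) +
    \int[singular_part nu mu]_x xi x
  else +oo.

End functional.

(* Main.v *)
(* Write t for tau, which is positive and finite mu-almost everywhere. The
   functional is a supremum of affine ones: I(nu) <= M if and only if nu(f) <= M
   for every bounded continuous f with mu(e^(t f)) <= 1.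

   The direct implication follows from h(r) >= r u - e^u + 1 with u = t f on the
   absolutely continuous part, and from f <= xi on the singular part. For the
   converse, Lusin's theorem extends the bound to the bounded Borel u with
   mu(e^(t u)) < 1 that lie below an envelope w with mu(e^(t w)) finite. These
   envelopes can be taken increasing to xi, which is infinite mu-almost
   everywhere, so that u may be chosen freely and independently on the two parts
   of nu: u = w gives nu_s(xi), and truncations of u = (log rho) / t, rho being
   the density of the tilted measure, give the entropy.

   Convexity and closedness of the sublevel sets are then immediate. As xi^oo is
   infinite, the test functions c phi - b together with Dini's theorem show that
   nu(f_n) tends to 0 uniformly on {I <= M} whenever the continuous f_n decrease
   to 0. Hence the limit of nu(f) along an ultrafilter on {I <= M} is a Daniell
   functional of f, and it is represented by a Borel probability measure. *)

From HB Require Import structures.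
Require Import Defs.
From mathcomp Require Import all_boot all_order all_algebra.
From mathcomp Require Import all_classical all_reals all_analysis.
From mathcomp Require Import measurable_realfun.
From mathcomp Require Import ring lra.

Set Implicit Arguments.
Unset Strict Implicit.
Unset Printing Implicit Defensive.

Import Order.TTheory GRing.Theory Num.Def Num.Theory.
Import numFieldNormedType.Exports.

Local Open Scope classical_set_scope.
Local Open Scope ring_scope.

(** The Lebesgue decomposition of [nu] is not narrowly continuous, so closedness of the sublevel
    sets cannot be read off the formula for I. In the dual form only nu(f) occurs, and the
    decomposition disappears. The entropy enters by a change of variables: with kappa = nu_a / t one
    has nu_a(f) = kappa(t f), and kappa is its mass z times the tilted probability P. Testing [nu]
    with f on the absolutely continuous part is testing P with t f, scaled by z. The obstacle in the
    converse is that t may be unbounded: a Lusin approximation of u is wrong on a set that is small,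
    yet e^(t f) may have an infinite integral there. Cutting at an envelope w supplies the
    dominating function e^(t w). The strict bound mu(e^(t u)) < 1 then leaves room for the
    approximations to satisfy the constraint eventually. In the converse kappa is not known to be
    finite at the start. The estimates therefore compare integrals of positive and negative parts,
    and z and nu_s(xi) are shown to be finite before anything is subtracted. *)

(** [g] is the distance to the complement of [U], truncated at 1. Adjoining 1 to the distances does
    the truncation and keeps the infimum over a nonempty set when [U] is the whole space. Continuity
    comes from the 1-Lipschitz bound [gd]. *)
Lemma open_bump (R : realType) (X : metricType R) (U : set X) : open U ->
  exists g : X -> R, [/\ continuous g, forall x, 0 <= g x <= 1 &
    forall x, U x <-> 0 < g x].
Proof.
move=> oU; pose S x := [set 1 : R] `|` [set mdist x y | y in ~` U].
have S1 x : S x 1 by left.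
have lbS x : lbound (S x) 0.
  by move=> _ [->|[y _ <-]]; [exact: ler01|exact: mdist_ge0].
have hlb x : has_lbound (S x) by exists 0.
have hinf x : has_inf (S x) by split => //; exists 1.
pose g x := inf (S x).
have gd x y : g x <= mdist x y + g y.
  rewrite -lerBlDl; apply: lb_le_inf; first by exists 1.
  move=> e [->|[z Uz <-]]; rewrite lerBlDl.
    by apply: (le_trans (ge_inf (hlb x) (S1 x))); rewrite lerDr mdist_ge0.
  apply: (le_trans (ge_inf (hlb x) _)); last exact: metric_triangle.
  by right; exists z.
exists g; split.
- move=> x; apply/cvgrPdist_lt => e e0.
  apply/metricType_numDomainType.nbhs_mdistP; exists e => // y /= xye.
  have := gd x y; have := gd y x; rewrite (metric_sym y x) => gyx gxy.
  by rewrite ltr_norml; apply/andP; split; lra.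
- by move=> x; rewrite lb_le_inf ?ge_inf//; exists 1.
- move=> x; split=> [Ux|].
    have /metricType_numDomainType.nbhs_mdistP[e /= e0 xeU] : nbhs x U
      by exact: open_nbhs_nbhs.
    apply: (@lt_le_trans _ _ (Num.min e 1)); first by rewrite lt_min e0 ltr01.
    apply: lb_le_inf; first by exists 1.
    move=> _ [->|[y Uy <-]]; rewrite ge_min ?lexx ?orbT//.
    by rewrite leNgt; apply/orP; left; apply/negP => /xeU.
  move=> g0; apply: contrapT => Ux; move: g0; apply/negP; rewrite -leNgt.
  by apply: ge_inf => //; right; exists x => //; rewrite mdistxx.
Qed.

Section borel_facts.
Context {R : realType} {X : polishMetricType R}.

Lemma open_borel (U : set X) : open U -> measurable (U : set (borel X)).
Proof. exact: sub_sigma_algebra. Qed.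

Lemma continuous_borel (f : X -> R) : continuous f ->
  measurable_fun (setT : set (borel X)) f.
Proof.
move=> cf; apply: (measurability _ (RGenOpens.measurableE R)) => //.
move=> _ [_ [a [b ->] <-]]; rewrite setTI; apply: open_borel.
by move/continuousP: cf; apply; exact: interval_open.
Qed.

End borel_facts.

(** * Lusin approximation by continuous functions *)

Lemma measure_vanishing_seq d (T : measurableType d) (R : realType)
    (m : {finite_measure set T -> \bar R}) (E : (set T)^nat) (e : R) :
  (forall n, measurable (E n)) -> nonincreasing_seq E -> m (\bigcap_n E n) = 0%E ->
  0 < e -> exists n, (m (E n) <= e%:E)%E.
Proof.
move=> mE ndE E0 e0.
have : m (E n) @[n --> \oo] --> m (\bigcap_n E n).
  apply: nonincreasing_cvg_mu => //; last exact: bigcap_measurable.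
  by rewrite ltey_eq fin_num_measure.
rewrite E0 => /fine_cvgP[_] /cvgrPdist_le/(_ _ e0)[n _ /(_ n (leqnn n))].
rewrite sub0r normrN => mEn; exists n.
rewrite -[X in (X <= _)%E]fineK ?fin_num_measure// lee_fin.
by apply: le_trans mEn; rewrite ler_norm.
Qed.

Lemma continuous_scale (R : realType) (X : topologicalType) (k : R) (g : X -> R) :
  continuous g -> continuous (fun x => k * g x).
Proof. by move=> cg x; apply: cvgM; [exact: cvg_cst|exact: cg]. Qed.

Lemma continuous_minr (R : realType) (X : topologicalType) (f g : X -> R) :
  continuous f -> continuous g -> continuous (fun x => Num.min (f x) (g x)).
Proof. by move=> cf cg x; apply: continuous_min; [exact: cf|exact: cg]. Qed.

Lemma continuous_maxr (R : realType) (X : topologicalType) (f g : X -> R) :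
  continuous f -> continuous g -> continuous (fun x => Num.max (f x) (g x)).
Proof. by move=> cf cg x; apply: continuous_max; [exact: cf|exact: cg]. Qed.

Lemma continuous_addr (R : realType) (X : topologicalType) (f g : X -> R) :
  continuous f -> continuous g -> continuous (fun x => f x + g x).
Proof. by move=> cf cg x; apply: cvgD; [exact: cf|exact: cg]. Qed.

Lemma continuous_sum (R : realType) (X : topologicalType) (f : nat -> X -> R) n :
  (forall k, continuous (f k)) -> continuous (fun x => \sum_(k < n) f k x).
Proof.
move=> cf; elim: n => [|n IH].
  by under eq_fun do rewrite big_ord0; move=> x; exact: cvg_cst.
by under eq_fun do rewrite big_ord_recr/=; exact: continuous_addr.
Qed.

(** The sum counts the integers from 1 to [n] that do not exceed [y]: it is the integer part of [y].
    Applied to [n%:R * u x], it approximates [u] by an average of indicators. *)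
Lemma layer_count (R : realType) (y : R) (n : nat) : 0 <= y <= n%:R ->
  y - 1 <= \sum_(k < n) (k.+1%:R <= y)%R%:R <= y.
Proof.
(* The induction step needs the saturated value of the sum beyond [n%:R] as well. *)
suff H : (n%:R <= y -> \sum_(k < n) (k.+1%:R <= y)%R%:R = n%:R :> R) /\
    (0 <= y <= n%:R -> y - 1 <= \sum_(k < n) (k.+1%:R <= y)%R%:R <= y).
  by move=> y0; apply: H.2.
elim: n => [|n [IH1 IH2]].
  by rewrite !big_ord0; split => // /andP[y0 yn]; apply/andP; split; lra.
rewrite !big_ord_recr /=; split => [ny|/andP[y0 yn]].
  have ny' : n%:R <= y by apply: le_trans ny; rewrite ler_nat.
  by rewrite ny IH1// -natr1.
have [ny|yn'] := leP n%:R y; last first.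
  have -> : (n.+1%:R <= y) = false.
    by apply/negbTE; rewrite -ltNge (lt_le_trans yn')// ler_nat.
  by rewrite addr0; apply: IH2; rewrite y0 ltW.
rewrite IH1//; have [ny1|ny1] := leP n.+1%:R y.
  by rewrite -natr1 in ny1 yn *; apply/andP; split; rewrite /=; lra.
by rewrite -natr1 in ny1 yn *; apply/andP; split; rewrite /=; lra.
Qed.

(** Clamping to [[-C, C]] is 1-Lipschitz and fixes [u]. *)
Lemma ler_dist_clamp (R : realType) (C z u : R) : - C <= u <= C ->
  `|Num.max (- C) (Num.min C z) - u| <= `|z - u|.
Proof.
move=> /andP[u1 u2]; have h1 := ler_norm (z - u); have := ler_norm (- (z - u)).
rewrite normrN ler_norml; move: h1; set t := `|_| => h1 h2.
case: (leP C z) => h3; [case: (leP (- C) C)|case: (leP (- C) z)] => h4;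
  by apply/andP; split; lra.
Qed.

Section lusin.
Context {R : realType} {X : polishMetricType R}.
Variable m : {finite_measure set (borel X) -> \bar R}.

(** Stated through functions with values in [0, 1], the property is stable under complement
    ([1 - g]) and union ([max]). A sigma-algebra argument then reaches all Borel sets without appeal
    to regularity of [m]. *)
Definition lusin_set (A : set X) := forall e : R, 0 < e ->
  exists (g : X -> R) (E : set (borel X)), [/\ continuous g,
    forall x, 0 <= g x <= 1, measurable E, (m E <= e%:E)%E &
    forall x, ~ E x -> g x = \1_A x].

(** For a bump [g] positive exactly on [U], the function min(1, n g) differs from the indicator only
    where 0 < g < 1/n, and these sets decrease to the empty set. *)
Lemma lusin_open (U : set X) : open U -> lusin_set U.
Proof.
move=> oU e e0; have [g [cg g01 Ug]] := open_bump oU.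
have g0 x : 0 <= g x by case/andP: (g01 x).
pose E n : set X := U `&` [set x | n%:R * g x < 1].
have oE n : open (E n).
  apply: openI => //; rewrite (_ : mkset _ = (fun x => n%:R * g x) @^-1` [set t | t < 1])//.
  by have /continuousP := continuous_scale (k := n%:R) cg; apply; exact: open_lt.
have [||| n mEn] := @measure_vanishing_seq _ _ _ m E e _ _ _ e0.
- by move=> n; exact: open_borel.
- move=> n k nk; apply/subsetPset => x [Ux /= kx]; split => //=.
  by apply: le_lt_trans kx; rewrite ler_wpM2r// ler_nat.
- rewrite (_ : \bigcap_n E n = set0) ?measure0//; apply/seteqP; split => // x Ex.
  have [/Ug gx0 _] := Ex O I.
  have := Ex (Num.truncn (g x)^-1).+1 I => -[_ /=].
  rewrite ltNge => /negP; apply; rewrite -ler_pdivrMr// mul1r.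
  by apply/ltW/truncnS_gt.
exists (fun x => Num.min 1 (n%:R * g x)), (E n); split => //.
- by apply: continuous_minr; [move=> x; exact: cvg_cst|exact: continuous_scale].
- by move=> x; rewrite le_min ler01 mulr_ge0//= ge_min lexx.
- exact: open_borel.
- move=> x nEx; rewrite indicE; have [Ux|nUx] := pselect (U x).
    rewrite mem_set//=; apply/min_idPl; rewrite leNgt; apply/negP => h.
    by apply: nEx; split.
  rewrite memNset//=; have -> : g x = 0.
    by apply/eqP; rewrite eq_le g0 andbT leNgt; apply/negP => /Ug.
  by rewrite mulr0 min_r.
Qed.

Lemma lusin_setC (A : set X) : lusin_set A -> lusin_set (~` A).
Proof.
move=> LA e e0; have [g [E [cg g01 mE mEe gA]]] := LA e e0.
exists (fun x => 1 - g x), E; split => //.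
- by move=> x; apply: cvgB; [exact: cvg_cst|exact: cg].
- by move=> x; have /andP[g0 g1] := g01 x; rewrite subr_ge0 g1 gerBl.
- by move=> x /gA ->; rewrite !indicE in_setC; case: (x \in A) => /=; lra.
Qed.

Lemma lusin_setU (A B : set X) : lusin_set A -> lusin_set B ->
  lusin_set (A `|` B).
Proof.
move=> LA LB e e0; have e20 : 0 < e / 2 by rewrite divr_gt0.
have [f [E [cf f01 mE mEe fA]]] := LA _ e20.
have [g [F [cg g01 mF mFe gB]]] := LB _ e20.
exists (fun x => Num.max (f x) (g x)), (E `|` F); split => //.
- exact: continuous_maxr.
- move=> x; have /andP[f0 f1] := f01 x; have /andP[g0 g1] := g01 x.
  by rewrite le_max f0/= ge_max f1 g1.
- exact: measurableU.
- apply: (le_trans (measureU2 _ mE mF)); rewrite [e]splitr EFinD.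
  exact: leeD.
- move=> x /not_orP[/fA -> /gB ->]; rewrite !indicE in_setU.
  by case: (x \in A); case: (x \in B) => /=; [rewrite maxxx|rewrite max_l|
    rewrite max_r|rewrite maxxx].
Qed.

(** By continuity from above a finite partial union misses only [e / 2] of the measure of the whole
    union; the other half of [e] pays for approximating the partial union. *)
Lemma lusin_bigcup (A : (set (borel X))^nat) : (forall n, measurable (A n)) ->
  (forall n, lusin_set (A n)) -> lusin_set (\bigcup_n A n).
Proof.
move=> mA LA e e0; have e20 : 0 < e / 2 by rewrite divr_gt0.
pose B n := \big[setU/set0]_(i < n) A i.
have mB n : measurable (B n) by exact: bigsetU_measurable.
have LB n : lusin_set (B n).
  rewrite /B; elim: n => [|n IH].
    by rewrite big_ord0; apply: lusin_open; exact: open0.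
  by rewrite big_ord_recr/=; exact: lusin_setU.
have mUA : measurable (\bigcup_n A n) by exact: bigcup_measurable.
have [||| n mn] := @measure_vanishing_seq _ _ _ m
    (fun n => \bigcup_n A n `\` B n) _ _ _ _ e20.
- by move=> n; exact: measurableD.
- move=> n k nk; apply/subsetPset; apply: setDS; exact: subset_bigsetU.
- rewrite (_ : \bigcap_n _ = set0) ?measure0//; apply/seteqP; split => // x Bx.
  have [[n _ Anx] _] := Bx O I.
  by have [_] := Bx n.+1 I; apply; rewrite /B big_ord_recr/=; right.
have [g [E [cg g01 mE mEe gB]]] := LB n _ e20.
exists g, (E `|` (\bigcup_n A n `\` B n)); split => //.
- by apply: measurableU => //; exact: measurableD.
- apply: (le_trans (measureU2 _ mE _)); first exact: measurableD.
  by rewrite [e]splitr EFinD leeD.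
- move=> x /not_orP[/gB -> h]; rewrite !indicE; congr ((nat_of_bool _)%:R).
  apply/idP/idP; rewrite !inE; first exact: bigsetU_bigcup.
  by move=> Ux; apply: contrapT => Bx; apply: h.
Qed.

Lemma borel_lusin (A : set (borel X)) : measurable A -> lusin_set A.
Proof.
(* Measurability is carried along because [lusin_bigcup] asks for it. *)
move=> mA; suff : [set B : set (borel X) | measurable B /\ lusin_set B] A by case.
apply: (smallest_sub _ _ mA).
  split => /=.
  - by split=> //; apply: lusin_open; exact: open0.
  - move=> B [mB LB]; rewrite setTD; split; first exact: measurableC.
    exact: lusin_setC.
  - move=> B LB; split; first by apply: bigcup_measurable => n _; case: (LB n).
    by apply: lusin_bigcup => n; case: (LB n).
by move=> U oU; split; [exact: open_borel|exact: lusin_open].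
Qed.

(** [u] is within 1/n of the average of the indicators of its [n] superlevel sets. Each indicator is
    made continuous outside a set of measure e/n, so that the exceptional sets add up to at most
    [e]. *)
Lemma lusin_itv01 (u : borel X -> R) (e : R) : measurable_fun setT u ->
  (forall x, 0 <= u x <= 1) -> 0 < e ->
  exists (g : X -> R) (E : set (borel X)), [/\ continuous g,
    forall x, 0 <= g x <= 1, measurable E, (m E <= e%:E)%E &
    forall x, ~ E x -> `|g x - u x| <= e].
Proof.
move=> mu u01 e0; have [n n0 ne] : exists2 n : nat, 0 < n%:R :> R & n%:R^-1 <= e.
  exists (Num.truncn e^-1).+1; first by rewrite ltr0n.
  by rewrite -[leRHS]invrK lef_pV2 ?posrE ?invr_gt0//; exact/ltW/truncnS_gt.
have en0 : 0 < e / n%:R by rewrite divr_gt0.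
have mA k : measurable [set x : borel X | k.+1%:R <= n%:R * u x].
  rewrite -[mkset _]setTI.
  by apply: measurable_fun_le => //; exact: measurable_funM.
have /choice[g /choice[E gE]] : forall k, exists (g : X -> R) (E : set (borel X)),
    [/\ continuous g, forall x, 0 <= g x <= 1, measurable E,
    (m E <= (e / n%:R)%:E)%E &
    forall x, ~ E x -> g x = \1_[set x : X | k.+1%:R <= n%:R * u x] x].
  by move=> k; exact: borel_lusin (mA k) _ en0.
have g0 k x : 0 <= g k x by case: (gE k) => _ /(_ x)/andP[].
have g1 k x : g k x <= 1 by case: (gE k) => _ /(_ x)/andP[].
exists (fun x => n%:R^-1 * \sum_(k < n) g k x), (\big[setU/set0]_(k < n) E k).
split.
- by apply: continuous_scale; apply: continuous_sum => k; case: (gE k).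
- move=> x; rewrite mulr_ge0 ?sumr_ge0 ?invr_ge0 ?(ltW n0)//=.
    rewrite ler_pdivrMl// mulr1; apply: (@le_trans _ _ (\sum_(k < n) 1)).
    exact: ler_sum.
  by rewrite sumr_const card_ord.
- by apply: bigsetU_measurable => k _; case: (gE k).
- apply: (le_trans (Boole_inequality _ _)).
    by move=> k _; case: (gE k).
  apply: (@le_trans _ _ (\sum_(k < n) (e / n%:R)%:E)%E).
    by apply: lee_sum => k _; case: (gE k).
  by rewrite sumEFin lee_fin sumr_const card_ord -[_ *+ _]mulr_natr divfK ?gt_eqF.
- move=> x nEx.
  have -> : \sum_(k < n) g k x = \sum_(k < n) (k.+1%:R <= n%:R * u x)%R%:R.
    apply: eq_bigr => k _; case: (gE k) => _ _ _ _ -> //.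
      by rewrite indicE; congr ((nat_of_bool _)%:R); apply/idP/idP; rewrite inE.
    by move=> Ekx; apply: nEx; rewrite -bigcup_mkord; exists k => //=.
  have /andP[u0 u1] := u01 x.
  have /layer_count/andP[] : 0 <= n%:R * u x <= n%:R.
    by rewrite mulr_ge0 ?(ltW n0)//= ler_piMr// ltW.
  set s := \sum_(_ < _) _ => h1 h2.
  apply: le_trans ne; rewrite -(ler_pM2l n0) divff ?gt_eqF//.
  rewrite -[X in X * _](gtr0_norm n0) -normrM mulrBr mulVKf ?gt_eqF//.
  by rewrite ler_norml; apply/andP; split; lra.
Qed.

(** Borel-Cantelli: the exceptional sets have summable measures, so almost every point lies in
    finitely many of them, and from then on the error is at most a multiple of [e k]. *)
Lemma lusin_seq (u : borel X -> R) (C : R) : measurable_fun setT u ->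
  (forall x, `|u x| <= C) ->
  exists f : nat -> X -> R, [/\ forall k, continuous (f k),
    forall k x, `|f k x| <= C & {ae m, forall x, f k x @[k --> \oo] --> u x}].
Proof.
move=> mu uC; have C0 : 0 <= C by apply: le_trans (uC point).
(* [D] replaces [C] in the affine change of variables onto [0, 1], as [C] may be 0. *)
pose D := C + 1; have D0 : 0 < D by rewrite ltr_wpDl.
have uD x : - C <= u x <= C by rewrite -ler_norml.
pose v x := (u x + C) / (2 * D).
have D20 : 0 < 2 * D by rewrite mulr_gt0.
have mv : measurable_fun setT v.
  by apply: measurable_funM => //; exact: measurable_funD.
have v01 x : 0 <= v x <= 1.
  have /andP[u1 u2] := uD x.
  by apply/andP; split; [apply: divr_ge0; [lra|exact: ltW]|rewrite ler_pdivrMr// /D; lra].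
pose e k : R := 1 / (2 ^ (k + 1))%:R.
have e0 k : 0 < e k by rewrite divr_gt0// ltr0n expn_gt0.
have /choice[g /choice[E gE]] := fun k => lusin_itv01 mv v01 (e0 k).
pose f k x := Num.max (- C) (Num.min C (2 * D * g k x - C)).
exists f; split.
- move=> k; apply: continuous_maxr; first by move=> x; exact: cvg_cst.
  apply: continuous_minr; first by move=> x; exact: cvg_cst.
  apply: continuous_addr; last by move=> x; exact: cvg_cst.
  by apply: continuous_scale; case: (gE k).
- move=> k x; rewrite ler_norml /f le_max lexx/= ge_max ge_min lexx/= andbT; lra.
exists (lim_sup_set E); split.
- by apply: bigcap_measurable => // n _; apply: bigcup_measurable => k _; case: (gE k).
- apply: lim_sup_set_cvg0; first by move=> k; case: (gE k).
  apply: (@le_lt_trans _ _ (\sum_(0 <= k <oo) (e k)%:E)%E).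
    by apply: lee_nneseries => // k _; case: (gE k).
  have /(cvg_lim (@ereal_hausdorff R)) := @cvg_geometric_eseries_half R 1 0.
  by rewrite /eseries => ->; rewrite ltry.
move=> x; apply: contra_notP => /= /existsNP[n /not_implyP[_ nE]].
have ecvg0 : e k @[k --> \oo] --> 0.
  apply: cvg_series_cvg_0; apply/cvg_ex; eexists.
  exact: (cvg_geometric_series_half 1 0).
have /cvgrPdist_le /= ecvg : 2 * D * e k @[k --> \oo] --> 0.
  by rewrite -[X in _ --> X](mulr0 (2 * D)); apply: cvgM => //; exact: cvg_cst.
apply/cvgrPdist_le => d d0; near=> k.
have := gE k => -[_ _ _ _ /(_ x)].
have nEk : ~ E k x.
  by move=> Ek; apply: nE; exists k => //=; near: k; exact: nbhs_infty_ge.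
move=> /(_ nEk) gv.
have : 2 * D * e k <= d.
  have : `|0 - 2 * D * e k| <= d by near: k; exact: ecvg.
  by rewrite sub0r normrN ger0_norm// mulr_ge0 ?ltW.
apply: le_trans.
have uE : u x = 2 * D * v x - C.
  by rewrite /v mulrCA divff ?gt_eqF// mulr1 addrK.
have : `|2 * D * g k x - C - u x| <= 2 * D * e k.
  rewrite uE (_ : _ - C - _ = 2 * D * (g k x - v x)); last by ring.
  by rewrite normrM gtr0_norm// ler_pM2l.
apply: le_trans; rewrite /f distrC; exact: ler_dist_clamp.
Unshelve. all: by end_near. Qed.

End lusin.

(** * Daniell functionals on bounded continuous functions *)

Lemma bounded_integrable d (T : measurableType d) (R : realType)
    (m : {finite_measure set T -> \bar R}) (f : T -> R) (M : R) :
  measurable_fun setT f -> (forall x, `|f x| <= M) ->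
  m.-integrable setT (EFin \o f).
Proof.
move=> mf fM; apply: (@le_integrable _ _ _ _ _ measurableT _ (cst M%:E)) => //.
- exact/measurable_EFinP.
- by move=> x _ /=; rewrite lee_fin (le_trans (fM x))// ler_norm.
- by apply: finite_measure_integrable_cst.
Qed.

(** The [k]-th term is the length of the part of [[0, y]] lying in [[k, k + 1]]. This is the
    continuous counterpart of [layer_count]. *)
Lemma layer_clamp (R : realType) (y : R) (n : nat) : 0 <= y <= n%:R ->
  \sum_(k < n) Num.min 1 (Num.max 0 (y - k%:R)) = y.
Proof.
suff H : 0 <= y -> \sum_(k < n) Num.min 1 (Num.max 0 (y - k%:R)) = Num.min y n%:R.
  by move=> /andP[y0 yn]; rewrite H//; exact/min_idPl.
move=> y0; elim: n => [|n IH]; first by rewrite big_ord0 min_r.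
rewrite big_ord_recr/= IH -natr1.
case: (leP y n%:R) => h1; case: (leP 0 (y - n%:R)) => h2;
  case: (leP y (n%:R + 1)) => h3; try case: leP => h4; try lra.
Qed.

Lemma layer_count_le (R : realType) (y : R) (n : nat) : 0 <= y ->
  \sum_(k < n) (k%:R < y)%R%:R <= y + 1.
Proof.
move=> y0; suff : \sum_(k < n) (k%:R < y)%R%:R <= Num.min n%:R (y + 1).
  by rewrite le_min => /andP[].
elim: n => [|n]; first by rewrite big_ord0 le_min lexx/=; lra.
rewrite big_ord_recr/= !le_min => /andP[h1 h2]; rewrite -natr1.
by case: ltP => h3; apply/andP; split; rewrite /=; lra.
Qed.

Section riesz.
Context {R : realType} (X : polishMetricType R).
Variable L : (X -> R) -> R.
Implicit Types (f g : X -> R) (A U V : set X) (e : R).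

Definition Cb (f : X -> R) := continuous f /\ exists M : R, forall x, `|f x| <= M.

Hypothesis LD : forall f g, Cb f -> Cb g -> L (fun x => f x + g x) = L f + L g.
Hypothesis LZ : forall c f, Cb f -> L (fun x => c * f x) = c * L f.
Hypothesis Lle : forall f g, Cb f -> Cb g -> (forall x, f x <= g x) -> L f <= L g.
Hypothesis L1 : L (fun=> 1) = 1.
(** Daniell's continuity condition. It does the work that compact supports do in the locally compact
    theory, namely to make the content of open sets countably subadditive. *)
Hypothesis Lcvg0 : forall f : nat -> X -> R, (forall n, Cb (f n)) ->
  (forall x, nonincreasing_seq (f^~ x)) -> (forall x, f n x @[n --> \oo] --> 0) ->
  forall e, 0 < e -> exists n, L (f n) <= e.

Lemma Cb_cst (c : R) : Cb (fun=> c).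
Proof. by split; [move=> x; exact: cvg_cst|exists `|c|]. Qed.

Lemma CbD f g : Cb f -> Cb g -> Cb (fun x => f x + g x).
Proof.
move=> [cf [M fM]] [cg [N gN]]; split; first exact: continuous_addr.
by exists (M + N) => x; rewrite (le_trans (ler_normD _ _))// lerD.
Qed.

Lemma CbZ c f : Cb f -> Cb (fun x => c * f x).
Proof.
move=> [cf [M fM]]; split; first exact: continuous_scale.
by exists (`|c| * M) => x; rewrite normrM ler_wpM2l.
Qed.

Lemma Cb_itv01 f : continuous f -> (forall x, 0 <= f x <= 1) -> Cb f.
Proof.
move=> cf f01; split=> //; exists 1 => x; have /andP[f0 f1] := f01 x.
by rewrite ger0_norm.
Qed.

Let L0 : L (fun=> 0) = 0.
Proof.
rewrite -[RHS](mul0r (L (fun=> 1))) -LZ; last exact: Cb_cst.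
by congr L; apply/funext => x; rewrite mul0r.
Qed.

Let Lsum (f : nat -> X -> R) n : (forall k, Cb (f k)) ->
  Cb (fun x => \sum_(k < n) f k x) /\
  L (fun x => \sum_(k < n) f k x) = \sum_(k < n) L (f k).
Proof.
move=> Cf; elim: n => [|n [IH1 IH2]].
  rewrite big_ord0; under [X in L X]eq_fun do rewrite big_ord0.
  by under [X in Cb X]eq_fun do rewrite big_ord0; split=> //; exact: Cb_cst.
rewrite big_ord_recr/=; under [X in L X]eq_fun do rewrite big_ord_recr/=.
under [X in Cb X]eq_fun do rewrite big_ord_recr/=.
by split; [exact: CbD|rewrite LD// IH2].
Qed.

(** * The content of open sets *)

(** Vanishing off [U] stands in for compact support in [U]: a Polish space need not be locally
    compact and may carry too few compactly supported functions. *)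
Definition subordinate (U : set X) : set (X -> R) :=
  [set f : X -> R | [/\ continuous f, forall x, 0 <= f x <= 1 & forall x, ~ U x -> f x = 0]].

Lemma subordinate_Cb U f : subordinate U f -> Cb f.
Proof. by move=> [cf f01 _]; exact: Cb_itv01. Qed.

Definition open_content (U : set X) : \bar R :=
  ereal_sup [set (L f)%:E | f in subordinate U].

Local Notation beta := open_content.
Local Open Scope ereal_scope.

Lemma open_content_ub U f : subordinate U f -> (L f)%:E <= beta U.
Proof. by move=> Uf; apply: ereal_sup_ubound; exists f. Qed.

Lemma subordinate0 U : subordinate U (fun=> 0%R).
Proof. by split=> //= x; [exact: cvg_cst|rewrite lexx ler01]. Qed.

Lemma open_content_ge0 U : 0 <= beta U.
Proof. by have := open_content_ub (subordinate0 U); rewrite L0. Qed.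

Lemma open_content_le1 U : beta U <= 1.
Proof.
apply: ge_ereal_sup => _ [f [cf f01 _] <-]; rewrite lee_fin -L1.
apply: Lle => //; [exact: Cb_itv01|exact: Cb_cst|].
by move=> x; case/andP: (f01 x).
Qed.

Lemma open_content_fin U : beta U \is a fin_num.
Proof.
by rewrite ge0_fin_numE ?open_content_ge0// (le_lt_trans (open_content_le1 U))// ltry.
Qed.

Lemma le_open_content U V : U `<=` V -> beta U <= beta V.
Proof.
move=> UV; apply: ge_ereal_sup => _ [f [cf f01 f0] <-]; apply: open_content_ub.
by split => // x nV; apply: f0 => /UV.
Qed.

(** A function subordinate to the union need not be carried by finitely many [U n]. Its minimum with
    the sum of the [psi n N], which increase with [N] to the indicators of the [U n], is, and
    [Lcvg0] makes the remainder small. *)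
Lemma open_content_bigcup (U : (set X)^nat) : (forall n, open (U n)) ->
  beta (\bigcup_n U n) <= \sum_(n <oo) beta (U n).
Proof.
move=> oU; apply: ge_ereal_sup => _ [f [cf f01 f0] <-].
have /choice[g gE] := fun n => open_bump (oU n).
have g0 n x : (0 <= g n x)%R by case: (gE n) => _ /(_ x)/andP[].
pose psi n N x := Num.min 1%R (N%:R * g n x)%R.
have psi_sub n N : subordinate (U n) (psi n N).
  case: (gE n) => cg _ Ug; split.
  - by apply: continuous_minr; [move=> x; exact: cvg_cst|exact: continuous_scale].
  - by move=> x; rewrite le_min ler01 mulr_ge0//= ge_min lexx.
  - move=> x nUx; rewrite /psi (_ : g n x = 0%R) ?mulr0 ?min_r//.
    by apply/eqP; rewrite eq_le g0 andbT leNgt; apply/negP => /Ug.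
have psi0 n N x : (0 <= psi n N x)%R by case: (psi_sub n N) => _ /(_ x)/andP[].
pose S N x := (\sum_(n < N) psi n N x)%R.
have CS N : Cb (S N) by apply: (Lsum N (fun k => subordinate_Cb (psi_sub k N))).1.
have LS N : L (S N) = (\sum_(n < N) L (psi n N))%R.
  by apply: (Lsum N (fun k => subordinate_Cb (psi_sub k N))).2.
have S0 N x : (0 <= S N x)%R by exact: sumr_ge0.
have homoS x m n : (m <= n)%N -> (S m x <= S n x)%R.
  move=> mn; rewrite /S -(subnKC mn) big_split_ord/= ler_wpDr ?sumr_ge0//.
  apply: ler_sum => k _; rewrite /psi le_min !ge_min lexx/=; apply/orP; right.
  by rewrite ler_wpM2r// ler_nat leq_addr.
(* [f - h N] decreases to 0, so that [L (h N)] tends to [L f]. *)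
pose h N x := Num.min (f x) (S N x).
have ff0 x : (0 <= f x)%R by case/andP: (f01 x).
have Ch N : Cb (h N).
  apply: Cb_itv01; first by apply: continuous_minr => //; case: (CS N).
  by move=> x; rewrite le_min ff0 S0/= ge_min; case/andP: (f01 x) => _ ->.
have Cf : Cb f by exact: Cb_itv01.
have Cd N : Cb (fun x => f x + - 1 * h N x)%R by apply: CbD => //; exact: CbZ.
apply/lee_addgt0Pr => e e0.
have [|||N LN] := @Lcvg0 (fun N x => f x + -1 * h N x)%R _ _ _ e e0.
- by [].
- move=> x m n mn; rewrite lerD2l !mulN1r lerN2 /h le_min !ge_min lexx/=.
  by rewrite homoS// orbT.
- move=> x; suff : \forall N \near \oo, (f x + -1 * h N x = 0)%R.
    move=> fh; apply/cvgrPdist_le => d d0; apply: filterS fh => N ->.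
    by rewrite subrr normr0 ltW.
  have [[n _ Unx]|nUx] := pselect ((\bigcup_n U n) x); last first.
    by apply: nearW => N; rewrite /h f0// min_l// mulr0 addr0.
  have gx : (0 < g n x)%R by case: (gE n) => _ _ /(_ x)[+ _]; exact.
  near=> N; have nN : (n < N)%N by near: N; exact: nbhs_infty_gt.
  rewrite mulN1r; apply/eqP; rewrite subr_eq0; apply/eqP/esym/min_idPl.
  rewrite /S (bigD1 (Ordinal nN))//= ler_wpDr ?sumr_ge0//.
  suff -> : psi n N x = 1%R by case/andP: (f01 x).
  apply/min_idPl; rewrite -ler_pdivrMr// mul1r; near: N.
  exact: nbhs_infty_ger.
have Lf : (L f <= \sum_(n < N) L (psi n N) + e)%R.
  have -> : L f = (L (h N) + L (fun x => f x + -1 * h N x))%R.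
    rewrite -LD//; congr L; apply/funext => x; ring.
  apply: lerD => //; rewrite -LS; apply: Lle => //.
  by move=> x; rewrite ge_min lexx orbT.
apply: (@le_trans _ _ (\sum_(n < N) beta (U n) + e%:E)).
  apply: (@le_trans _ _ ((\sum_(n < N) L (psi n N))%R + e)%:E) => //.
  by rewrite EFinD leeD2r// -sumEFin; apply: lee_sum => n _; exact: open_content_ub.
rewrite leeD2r// -(big_mkord xpredT (fun n => beta (U n))).
by apply: nneseries_lim_ge => n _ _; exact: open_content_ge0.
Unshelve. all: by end_near. Qed.

(** * The outer measure and its Borel restriction *)

Definition riesz_outer (A : set X) : \bar R :=
  ereal_inf [set beta U | U in [set U : set X | open U /\ A `<=` U]].

Local Notation nuo := riesz_outer.

Lemma riesz_outer_open U : open U -> nuo U = beta U.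
Proof.
move=> oU; apply/eqP; rewrite eq_le; apply/andP; split.
  by apply: ereal_inf_lbound; exists U => //; split => //; exact: subset_refl.
by apply: le_ereal_inf_tmp => _ [V [_ UV] <-]; exact: le_open_content.
Qed.

Let nuo0 : nuo set0 = 0.
Proof.
rewrite riesz_outer_open; last exact: open0.
apply/eqP; rewrite eq_le open_content_ge0 andbT.
apply: ge_ereal_sup => _ [f [_ _ f0] <-].
by rewrite (_ : f = fun=> 0%R) ?L0//; apply/funext => x; rewrite f0.
Qed.

Let nuo_ge0 A : 0 <= nuo A.
Proof. by apply: le_ereal_inf_tmp => _ [U _ <-]; exact: open_content_ge0. Qed.

Let nuo_fin A : nuo A \is a fin_num.
Proof.
rewrite ge0_fin_numE//; apply: (@le_lt_trans _ _ (beta setT)).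
  by apply: ereal_inf_lbound; exists setT => //; split=> //; exact: openT.
by rewrite ltey_eq open_content_fin.
Qed.

Let le_nuo : {homo nuo : A B / A `<=` B >-> A <= B}.
Proof.
move=> A B AB; apply: ereal_inf_le_tmp => _ [U [oU BU] <-].
by exists U => //; split=> //; exact: subset_trans BU.
Qed.

Let nuo_sigma_subadditive : sigma_subadditive nuo.
Proof.
move=> F; apply/lee_addgt0Pr => e e0.
have /choice[U UE] : forall n, exists U : set X, [/\ open U, F n `<=` U &
    beta U <= nuo (F n) + (e / (2 ^ n.+1)%:R)%:E].
  move=> n; have en0 : (0 < e / (2 ^ n.+1)%:R)%R by rewrite divr_gt0// ltr0n expn_gt0.
  have [_ [U [oU FU] <-] ltU] := lb_ereal_inf_adherent en0 (nuo_fin (F n)).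
  by exists U; split => //; exact: ltW.
apply: (@le_trans _ _ (beta (\bigcup_n U n))).
  apply: ereal_inf_lbound; exists (\bigcup_n U n) => //; split.
    by apply: bigcup_open => n _; case: (UE n).
  by apply: subset_bigcup => n _; case: (UE n).
apply: (le_trans (open_content_bigcup _)); first by move=> n; case: (UE n).
apply: le_trans (epsilon_trick _ _ _); [|by []|exact: ltW].
by apply: lee_nneseries => n *; [exact: open_content_ge0|case: (UE n)].
Qed.

HB.instance Definition _ := isOuterMeasure.Build R X nuo
  nuo0 nuo_ge0 le_nuo nuo_sigma_subadditive.

Lemma open_riesz_caratheodory U : open U -> nuo.-caratheodory U.
Proof.
move=> oU; apply: le_caratheodory_measurable => A.
apply: le_ereal_inf_tmp => _ [V [oV AV] <-].
apply: (@le_trans _ _ (nuo (V `&` U) + nuo (V `&` ~` U))).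
  by apply: leeD; apply: le_nuo; exact: setSI.
rewrite riesz_outer_open; last exact: openI.
rewrite -leeBrDr//; apply: ge_ereal_sup => _ [f [cf f01 f0] <-].
rewrite leeBrDr//; apply/lee_addgt0Pr => e e0.
(* [max 0 (f - e)] vanishes on [W], which contains [V `\` U]: adding to it a
   function subordinate to [W] gives a function subordinate to [V]. *)
pose W : set X := V `&` [set x | f x < e]%R.
have oW : open W.
  apply: openI => //; rewrite (_ : mkset _ = f @^-1` [set t | t < e]%R)//.
  by move/continuousP: cf; apply; exact: open_lt.
pose f' x := Num.max 0%R (f x - e)%R.
have cf' : continuous f'.
  apply: continuous_maxr; first by move=> x; exact: cvg_cst.
  by apply: continuous_addr => // x; exact: cvg_cst.
have f'01 x : (0 <= f' x <= 1)%R.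
  have /andP[fx0 fx1] := f01 x.
  by rewrite le_max lexx/= ge_max ler01/=; lra.
have Cf : Cb f by exact: Cb_itv01.
have Cf' : Cb f' by exact: Cb_itv01.
have Lf : (L f <= L f' + e)%R.
  have <- : L (fun x => f' x + e * 1)%R = (L f' + e)%R.
    by rewrite LD ?LZ ?L1 ?mulr1//; do ?[exact: Cb_cst|exact/CbZ/Cb_cst].
  apply: Lle => //; first by apply: CbD => //; exact/CbZ/Cb_cst.
  by move=> x; rewrite mulr1 -lerBlDr le_max lexx orbT.
apply: (@le_trans _ _ ((L f' + e)%:E + beta W)).
  apply: leeD; first by rewrite lee_fin.
  rewrite -riesz_outer_open//; apply: le_nuo => x [Vx nUx]; split=> //=.
  by rewrite f0//; case.
rewrite EFinD addeAC leeD2r// addeC -leeBrDr//.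
apply: ge_ereal_sup => _ [g [cg g01 g0] <-]; rewrite leeBrDr// -EFinD.
rewrite -LD//; last exact: Cb_itv01.
apply: open_content_ub; split.
- exact: continuous_addr.
- move=> x; have /andP[fx0 fx1] := f'01 x; have /andP[gx0 gx1] := g01 x.
  rewrite addr_ge0//=; have [Wx|nWx] := pselect (W x); last by rewrite g0// add0r.
  suff -> : f' x = 0%R by rewrite addr0.
  by apply/max_idPl; rewrite subr_le0 ltW//; case: Wx.
- move=> x nVx; rewrite g0; last by case.
  by rewrite /f' f0; [rewrite max_l ?addr0//; lra|case].
Qed.

Definition riesz_measure (A : set (borel X)) : \bar R := nuo A.

Let borel_caratheodory (A : set (borel X)) : measurable A -> nuo.-caratheodory A.
Proof.
apply: smallest_sub; last exact: open_riesz_caratheodory.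
split.
- exact: caratheodory_measurable_set0.
- by move=> B mB; rewrite setTD; exact: caratheodory_measurable_setC.
- by move=> B mB; exact: caratheodory_measurable_bigcup.
Qed.

Let riesz_sigma_additive : semi_sigma_additive riesz_measure.
Proof.
move=> F mF tF mUF.
apply: (caratheodory_measure_sigma_additive (mu := nuo)) => //.
  by move=> n; exact: borel_caratheodory.
exact: borel_caratheodory.
Qed.

HB.instance Definition _ := isMeasure.Build _ _ _ riesz_measure
  nuo0 nuo_ge0 riesz_sigma_additive.

Let riesz_measureT : riesz_measure setT = 1.
Proof.
rewrite /riesz_measure riesz_outer_open; last exact: openT.
apply/eqP; rewrite eq_le open_content_le1/= -L1; apply: open_content_ub.
by split=> x; [exact: cvg_cst|rewrite ler01 lexx|move=> []].
Qed.

HB.instance Definition _ := Measure_isProbability.Build _ _ _ riesz_measure riesz_measureT.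

(** * Integral representation *)

Let nu : probability (borel X) R := riesz_measure.

Let Cb_int (f : X -> R) : Cb f -> nu.-integrable setT (EFin \o f).
Proof.
by move=> [cf [M fM]]; apply: (bounded_integrable nu (continuous_borel cf) fM).
Qed.

Let int1 : Rintegral nu setT (fun=> 1%R) = 1%R.
Proof.
by rewrite (Rintegral_cst _ measurableT) mul1r (congr1 fine (probability_setT nu)).
Qed.

(** [n%:R * f] is cut into layers [fk k] subordinate to the sets [U k] where it exceeds [k]. Each
    layer satisfies L(fk) <= nu(U k), and the indicators of the [U k] sum to at most n f + 1; the
    error 1 becomes 1/n after division. *)
Let L_le_integral01 (f : X -> R) : continuous f -> (forall x, 0 <= f x <= 1)%R ->
  (L f <= Rintegral nu setT f)%R.
Proof.
move=> cf f01; have Cf := Cb_itv01 cf f01.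
apply/ler_addgt0Pr => e e0.
have [n n0 ne] : exists2 n : nat, (0 < n%:R :> R)%R & (n%:R^-1 <= e)%R.
  exists (Num.truncn e^-1).+1; first by rewrite ltr0n.
  by rewrite -[leRHS]invrK lef_pV2 ?posrE ?invr_gt0//; exact/ltW/truncnS_gt.
pose fk k x := Num.min 1%R (Num.max 0%R (n%:R * f x - k%:R)%R).
have cnf : continuous (fun x => n%:R * f x)%R by exact: continuous_scale.
pose U k : set X := [set x | k%:R < n%:R * f x]%R.
have oU k : open (U k).
  rewrite (_ : U k = (fun x => n%:R * f x)%R @^-1` [set t | k%:R < t]%R)//.
  by move/continuousP: cnf; apply; exact: open_gt.
have fk_sub k : subordinate (U k) (fk k).
  split.
  - apply: continuous_minr; first by move=> x; exact: cvg_cst.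
    apply: continuous_maxr; first by move=> x; exact: cvg_cst.
    by apply: continuous_addr => // x; exact: cvg_cst.
  - by move=> x; rewrite le_min ler01 le_max lexx/= ge_min lexx.
  - move=> x /negP; rewrite -leNgt => nf; rewrite /fk max_l ?min_r//.
    by rewrite subr_le0.
have nL : (n%:R * L f = \sum_(k < n) L (fk k))%R.
  rewrite -LZ// -(Lsum n (fun k => subordinate_Cb (fk_sub k))).2.
  congr L; apply/funext => x; rewrite layer_clamp//.
  by have /andP[f0 f1] := f01 x; rewrite mulr_ge0 ?(ltW n0)//= ler_piMr// ltW.
suff : (n%:R * L f <= n%:R * Rintegral nu setT f + 1)%R.
  rewrite -ler_pdivlMl// mulrDr mulKf ?gt_eqF// mulr1 => /le_trans; apply.
  by rewrite lerD2l.
have mU k : measurable (U k : set (borel X)) by exact: open_borel.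
have intU k : nu.-integrable setT (EFin \o (\1_(U k) : X -> R)).
  apply: (@bounded_integrable _ _ _ _ _ 1%R); first exact: measurable_indic.
  by move=> x; rewrite indicE ger0_norm// lern1 leq_b1.
apply: (@le_trans _ _ (Rintegral nu setT (fun x => \sum_(k < n) \1_(U k) x)%R)).
  rewrite nL /Rintegral; under [X in (_ <= fine X)%R]eq_integral do rewrite -sumEFin.
  rewrite integral_sum//; last by move=> k; exact: intU.
  rewrite -lee_fin fineK; last first.
    by apply/sum_fin_numP => k _ _; exact: integrable_fin_num (intU k).
  rewrite -sumEFin; apply: lee_sum => k _; rewrite integral_indic// setIT.
  apply: (le_trans (open_content_ub (fk_sub k))).
  by rewrite -riesz_outer_open//; exact: lexx.
have intf1 : nu.-integrable setT (EFin \o (fun x => n%:R * f x + 1)%R).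
  by apply: Cb_int; apply: CbD; [exact: CbZ|exact: Cb_cst].
apply: (@le_trans _ _ (n%:R * Rintegral nu setT f + Rintegral nu setT (fun=> 1))%R);
  last by rewrite int1.
rewrite -RintegralZl//; last exact: Cb_int.
rewrite -RintegralD//; [|exact/Cb_int/CbZ|exact/Cb_int/Cb_cst].
apply: le_Rintegral => //.
  apply: (@bounded_integrable _ _ _ _ _ n%:R).
    by apply: measurable_sum => k; exact: measurable_indic.
  move=> x; rewrite ger0_norm ?sumr_ge0//.
  apply: (@le_trans _ _ (\sum_(k < n) 1)%R); last by rewrite sumr_const card_ord.
  by apply: ler_sum => k _; rewrite indicE lern1 leq_b1.
move=> x _; have /andP[f0 f1] := f01 x.
apply: le_trans (layer_count_le n _); last by rewrite mulr_ge0// ltW.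
by apply: ler_sum => k _; rewrite indicE ler_nat; case: (boolP (x \in _)) => //;
  rewrite inE /U/= => ->.
Qed.

Let L_integral01 (f : X -> R) : continuous f -> (forall x, 0 <= f x <= 1)%R ->
  L f = Rintegral nu setT f.
Proof.
move=> cf f01; apply/eqP; rewrite eq_le L_le_integral01//=.
have Cf := Cb_itv01 cf f01.
(* The reverse inequality is the same bound for 1 - f. *)
have := @L_le_integral01 (fun x => 1 + -1 * f x)%R.
rewrite LD//; [|exact: Cb_cst|exact: CbZ].
rewrite LZ// L1 RintegralD//; [|exact/Cb_int/Cb_cst|exact/Cb_int/CbZ].
rewrite RintegralZl//; last exact: Cb_int.
rewrite int1.
suff : (forall x, 0 <= 1 + -1 * f x <= 1)%R /\ continuous (fun x => 1 + -1 * f x)%R.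
  by move=> [h1 h2] /(_ h2 h1); lra.
split; last by apply: continuous_addr; [move=> x; exact: cvg_cst|exact: continuous_scale].
by move=> x; have /andP[f0 f1] := f01 x; apply/andP; split; lra.
Qed.

Lemma riesz_representation : exists nu : probability (borel X) R,
  forall f : X -> R, Cb f -> L f = Rintegral nu setT f.
Proof.
exists nu => f Cf; have [cf [M fM]] := Cf.
(* An affine change of variables with positive scale [D] brings [f] into [0, 1]. *)
pose D := (Num.max M 1)%R; have D0 : (0 < D)%R by rewrite lt_max ltr01 orbT.
pose g x := ((2 * D)^-1 * (f x + D))%R.
have fD x : (- D <= f x <= D)%R by rewrite -ler_norml (le_trans (fM x))// le_max lexx.
have cg : continuous g.
  by apply: continuous_scale; apply: continuous_addr => // x; exact: cvg_cst.
have g01 x : (0 <= g x <= 1)%R.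
  have /andP[f1 f2] := fD x; rewrite mulr_ge0 ?invr_ge0/=; [|lra|lra].
  by rewrite ler_pdivrMl ?mulr1; lra.
have Cg := Cb_itv01 cg g01.
have -> : f = (fun x => 2 * D * g x + - D * 1)%R.
  by apply/funext => x; rewrite /g mulVKf; [ring|rewrite mulf_neq0// gt_eqF].
have C1 := Cb_cst 1.
rewrite LD//; [|exact: CbZ|exact: CbZ].
rewrite (LZ (2 * D) Cg) (LZ (- D) C1) RintegralD//; [|exact/Cb_int/CbZ|exact/Cb_int/CbZ].
rewrite (RintegralZl _ measurableT (Cb_int Cg)) (RintegralZl _ measurableT (Cb_int C1)).
by rewrite L_integral01// L1 int1.
Qed.

End riesz.

(** * Compactness in the narrow topology *)

Section narrow_compactness.
Context {R : realType} {X : polishMetricType R}.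

Lemma Cb_integrable (m : {finite_measure set (borel X) -> \bar R}) (f : X -> R) :
  Cb f -> m.-integrable setT (EFin \o f).
Proof.
by move=> [cf [M fM]]; apply: (bounded_integrable m (continuous_borel cf) fM).
Qed.

Lemma Rintegral_bounded (nu : probability (borel X) R) (f : X -> R) (M : R) :
  continuous f -> (forall x, `|f x| <= M) -> - M <= Rintegral nu setT f <= M.
Proof.
move=> cf fM; have Cf : Cb f by split=> //; exists M.
have nuc c : Rintegral nu setT (fun=> c) = c.
  by rewrite (Rintegral_cst _ measurableT) (congr1 fine (probability_setT nu)) mulr1.
have fM' x : - M <= f x <= M by rewrite -ler_norml.
rewrite -[X in X <= _ <= _](nuc (- M)) -[X in _ <= _ <= X]nuc; apply/andP; split.
  by apply: le_Rintegral => //; [exact/Cb_integrable/Cb_cst|exact: Cb_integrable|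
    move=> x _; case/andP: (fM' x)].
by apply: le_Rintegral => //; [exact: Cb_integrable|exact/Cb_integrable/Cb_cst|
    move=> x _; case/andP: (fM' x)].
Qed.

Lemma initial_cvg (S : choiceType) (T : topologicalType) (f : S -> T)
    (F : set_system S) (s : S) : Filter F ->
  f x @[x --> F] --> f s -> F --> (s : initial_topology f).
Proof.
move=> FF fF A /= [_ [[B Bop <-] Bfs sBfA]].
by apply: filterS sBfA _; apply: fF; exact: open_nbhs_nbhs.
Qed.

Lemma narrow_cvg (F : set_system (narrow X)) (nu : narrow X) : Filter F ->
  (forall f : bounded_continuous X, narrow_eval f x @[x --> F] --> narrow_eval f nu) ->
  F --> nu.
Proof.
by move=> FF Fnu; apply/cvg_sup => f; exact: initial_cvg.
Qed.

Lemma narrow_eval_continuous (f : bounded_continuous X) :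
  continuous (narrow_eval f : narrow X -> R).
Proof.
move=> nu; have /cvg_sup/(_ f) h : nbhs nu --> nu by exact: cvg_id.
apply: cvg_trans (initial_continuous (f := narrow_eval f) (x := nu)).
exact: cvg_app h.
Qed.

Lemma narrow_compact (S : set (narrow X)) : closed S ->
  (forall f : nat -> X -> R, (forall n, Cb (f n)) ->
    (forall x, nonincreasing_seq (f^~ x)) ->
    (forall x, f n x @[n --> \oo] --> 0) ->
    forall e, 0 < e -> exists n, forall nu : probability (borel X) R, S nu ->
      Rintegral nu setT (f n) <= e) ->
  compact S.
Proof.
move=> cS tS; rewrite compact_ultra => F UF FS.
pose I (f : X -> R) (nu : narrow X) := Rintegral (nu : probability (borel X) R) setT f.
pose L (f : X -> R) : R := lim (I f x @[x --> F]).
have Icvg f : Cb f -> I f x @[x --> F] --> L f.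
  move=> Cf; have [cf [M fM]] := Cf.
  have FM : F (I f @^-1` `[- M, M]).
    apply: filterS FS => nu _; rewrite /= in_itv/=.
    exact: (Rintegral_bounded (nu : probability (borel X) R) cf fM).
  (* Compactness of [[-M, M]] yields a cluster point only; the image of an ultrafilter converges to
     each of its cluster points. *)
  have [l [_ Fl]] := @segment_compact R (- M) M (I f x @[x --> F]) _ FM.
  suff Fcvg : I f x @[x --> F] --> l by have -> : L f = l by exact/cvg_lim.
  move=> B lB; have [//|FnB] := in_ultra_setVsetC (I f @^-1` B) UF.
  by have [y [nBy By]] := Fl (~` B) B FnB lB.
have [|||||nu nuE] := @riesz_representation R X L.
- move=> f g Cf Cg; apply/cvg_lim => //.
  rewrite (_ : I _ = fun nu => I f nu + I g nu); first exact: cvgD (Icvg _ Cf) (Icvg _ Cg).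
  by apply/funext => nu; rewrite /I RintegralD//; exact: Cb_integrable.
- move=> c f Cf; apply/cvg_lim => //.
  rewrite (_ : I _ = fun nu => c * I f nu); first by apply: cvgM; [exact: cvg_cst|exact: Icvg].
  by apply/funext => nu; rewrite /I RintegralZl//; exact: Cb_integrable.
- move=> f g Cf Cg fg.
  apply: (ler_cvg_to (Icvg _ Cf) (Icvg _ Cg)); apply: nearW => nu.
  by apply: le_Rintegral => //; exact: Cb_integrable.
- apply/cvg_lim => //; rewrite (_ : I _ = cst 1); first exact: cvg_cst.
  apply/funext => nu; rewrite /I (Rintegral_cst _ measurableT) mul1r.
  by rewrite (congr1 fine (probability_setT nu)).
- move=> f Cf ndf f0 e e0; have [n nS] := tS f Cf ndf f0 e e0.
  exists n; apply: (ler_cvg_to (Icvg _ (Cf n)) (cvg_cst e)).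
  by apply: filterS FS => nu Snu; exact: nS.
have Fnu : F --> (nu : narrow X).
  apply: narrow_cvg => f; rewrite /narrow_eval.
  by rewrite -nuE; [apply: Icvg; exact: (svalP f)|exact: (svalP f)].
exists nu; split => //.
by apply: cS => B /Fnu FB; exact: filter_ex (filterI FS FB).
Qed.

End narrow_compactness.

(** * Relative entropy *)

Import HBNNSimple.

(** Proved from simple functions by monotone convergence, without any finiteness of [m] or [nu]: it
    is applied to the tilt of [nu] before the mass of that tilt is known to be finite. *)
Lemma integral_density d (T : measurableType d) (R : realType)
    (m nu : {measure set T -> \bar R}) (k : T -> R) (g : T -> \bar R) :
  measurable_fun setT k -> (forall x, 0 <= k x) ->
  (forall A, measurable A -> m A = \int[nu]_(x in A) (k x)%:E)%E ->
  measurable_fun setT g -> (forall x, 0 <= g x)%E ->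
  (\int[m]_x g x = \int[nu]_x (g x * (k x)%:E))%E.
Proof.
move=> mk k0 mE mg g0; pose h := nnsfun_approx measurableT mg.
have hk : measurable_fun setT (EFin \o k) by exact/measurable_EFinP.
have -> : (\int[m]_x g x = lim (\int[m]_x (EFin \o h n) x @[n --> \oo]))%E.
  have gE x : g x = lim ((EFin \o h n) x @[n --> \oo]).
    by apply/esym/cvg_lim => //; exact: cvg_nnsfun_approx.
  under eq_integral do rewrite gE.
  apply: monotone_convergence => //.
  - by move=> n; apply/measurable_EFinP; exact/measurable_funP.
  - by move=> n x _ /=; rewrite lee_fin.
  - by move=> x _ a b ab; rewrite lee_fin; exact/lefP/nd_nnsfun_approx.
have -> : (\int[nu]_x (g x * (k x)%:E) =
    lim (\int[nu]_x ((EFin \o h n) x * (k x)%:E) @[n --> \oo]))%E.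
  have gE x : (g x * (k x)%:E = lim ((EFin \o h n) x * (k x)%:E @[n --> \oo]))%E.
    by apply/esym/cvg_lim => //; apply: cvgeZr => //; exact: cvg_nnsfun_approx.
  under eq_integral do rewrite gE.
  apply: monotone_convergence => //.
  - by move=> n; apply: emeasurable_funM => //; apply/measurable_EFinP; exact/measurable_funP.
  - by move=> n x _ /=; rewrite mule_ge0 ?lee_fin.
  - move=> x _ a b ab; rewrite lee_wpmul2r ?lee_fin//.
    exact/lefP/nd_nnsfun_approx.
congr (lim (_ @ \oo)); apply/funext => n.
have mh r : measurable (h n @^-1` [set r]) by [].
transitivity (\sum_(r \in range (h n)) r%:E * m (h n @^-1` [set r]))%E.
  by rewrite integral_nnsfun// sintegralE patch_setT.
under [RHS]eq_integral => x _.
  rewrite /= fimfunE -fsumEFin// ge0_mule_fsuml; last first.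
    by move=> r; exact: nnfun_muleindic_ge0.
  over.
rewrite ge0_integral_fsum//; last 2 first.
- move=> r; apply: emeasurable_funM => //; apply/measurable_EFinP.
  by apply: measurable_funM => //; exact: measurable_indic.
- by move=> r x _; rewrite mule_ge0 ?lee_fin//; exact: nnfun_muleindic_ge0.
apply: eq_fsbigr => r; rewrite inE => -[y _ <-].
under eq_integral do rewrite EFinM -muleA.
rewrite ge0_integralZl//; last 3 first.
- apply: emeasurable_funM => //; apply/measurable_EFinP; exact: measurable_indic.
- by move=> x _; rewrite mule_ge0 ?lee_fin.
- by rewrite lee_fin.
rewrite mE//; congr (_ * _)%E; rewrite integral_mkcond; apply: eq_integral => x _.
by rewrite epatch_indic muleC.
Qed.

(** For [r > 0] this is 1 - ln r <= 1/r multiplied by [r]; for [r <= 0] the convention [ln r = 0]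
    leaves 1 - r. *)
Lemma entropy_fun_ge0 (R : realType) (r : R) : 0 <= entropy_fun r.
Proof.
rewrite /entropy_fun; have [r0|r0] := leP r 0.
  by rewrite ln0// sub0r mulrN1; lra.
have := @expR_ge1Dx R (- ln r); rewrite expRN lnK ?posrE// => h.
have : r * (1 - ln r) <= r * r^-1 by rewrite ler_pM2l.
rewrite divff ?gt_eqF//; lra.
Qed.

(* [expR u - 1] is the convex conjugate of [entropy_fun]. *)
Lemma entropy_fun_young (R : realType) (r u : R) : 0 <= r ->
  r * u - expR u + 1 <= entropy_fun r.
Proof.
rewrite le_eqVlt => /predU1P[<-|r0].
  by rewrite /entropy_fun !mul0r add0r; have := expR_gt0 u; lra.
have := @expR_ge1Dx R (u - ln r); rewrite expRB lnK ?posrE// => h.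
have : r * (1 + (u - ln r)) <= r * (expR u / r) by rewrite ler_pM2l.
rewrite mulrCA divff ?gt_eqF// mulr1 /entropy_fun; lra.
Qed.

Section relative_entropy_density.
Context d (T : measurableType d) (R : realType).
Variables (nu mu : probability T R).

Lemma relative_entropy_ge0 : (0 <= relative_entropy nu mu)%E.
Proof.
rewrite /relative_entropy; case: ifPn => // _.
by apply: integral_ge0 => x _; rewrite lee_fin entropy_fun_ge0.
Qed.

Lemma measurable_entropy_fun : measurable_fun setT (@entropy_fun R).
Proof.
apply: measurable_funD => //; apply: measurable_funM => //.
by apply: measurable_funB => //; exact: measurable_ln.
Qed.

(** The derivative in [relative_entropy] is exchanged for a version equal to it [mu]-almost
    everywhere that is finite and nonnegative at every point. *)
Lemma relative_entropy_density : nu `<< mu -> exists rho : T -> R,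
  [/\ measurable_fun setT rho, forall x, 0 <= rho x,
    forall g : T -> \bar R, measurable_fun setT g -> (forall x, 0 <= g x)%E ->
      (\int[nu]_x g x = \int[mu]_x (g x * (rho x)%:E))%E &
    relative_entropy nu mu = (\int[mu]_x (entropy_fun (rho x))%:E)%E].
Proof.
move=> numu; pose f := Radon_Nikodym_SigmaFinite.f nu mu.
have f0 x : (0 <= f x)%E by exact: Radon_Nikodym_SigmaFinite.f_ge0.
have ffin x : f x \is a fin_num by exact: Radon_Nikodym_SigmaFinite.f_fin_num.
have mf : measurable_fun setT f.
  exact: measurable_int (Radon_Nikodym_SigmaFinite.f_integrable numu).
have mrho : measurable_fun setT (fine \o f) by exact: measurableT_comp.
exists (fine \o f); split => //.
- by move=> x; rewrite /= fine_ge0.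
- move=> g mg g0; apply: integral_density => //.
    by move=> x; rewrite /= fine_ge0.
  move=> A mA; apply: (etrans (Radon_Nikodym_SigmaFinite.f_integral numu mA)).
  by apply: eq_integral => x _; rewrite /= fineK.
rewrite /relative_entropy asboolT//; apply: ge0_ae_eq_integral => //.
- apply/measurable_EFinP; apply: (measurableT_comp measurable_entropy_fun).
  exact: measurableT_comp.
- by apply/measurable_EFinP; exact: (measurableT_comp measurable_entropy_fun).
- by move=> x _; rewrite lee_fin entropy_fun_ge0.
- by move=> x _; rewrite lee_fin entropy_fun_ge0.
have := ae_eq_Radon_Nikodym_SigmaFinite numu measurableT.
by apply: filterS => x /= h _; rewrite -h.
Qed.

End relative_entropy_density.

(** Turns an inequality on a real integral into one between nonnegative extended integrals. The
    latter can be split over the two parts of [nu] or carried to the tilt without integrability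
    conditions. *)
Lemma Rintegral_pos_neg d (T : measurableType d) (R : realType)
    (P : {finite_measure set T -> \bar R}) (v : T -> R) (C : R) :
  measurable_fun setT v -> (forall x, `|v x| <= C) ->
  exists a b : R, [/\ (\int[P]_x (Num.max (v x) 0)%:E = a%:E)%E,
    (\int[P]_x (Num.max (- v x) 0)%:E = b%:E)%E & Rintegral P setT v = a - b].
Proof.
move=> mv vC; have iv := bounded_integrable P mv vC.
have ip : P.-integrable setT (EFin \o (fun x => Num.max (v x) 0)).
  apply: eq_integrable (integrable_funepos measurableT iv) => // x _.
  by rewrite ?funeposE ?funenegE /= EFin_max.
have iN : P.-integrable setT (EFin \o (fun x => Num.max (- v x) 0)).
  apply: eq_integrable (integrable_funeneg measurableT iv) => // x _.
  by rewrite ?funeposE ?funenegE /= EFin_max.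
exists (Rintegral P setT (fun x => Num.max (v x) 0)),
  (Rintegral P setT (fun x => Num.max (- v x) 0)); split.
- by rewrite /Rintegral fineK//; exact: integrable_fin_num.
- by rewrite /Rintegral fineK//; exact: integrable_fin_num.
rewrite -RintegralB//; apply: eq_Rintegral => x _.
by rewrite /Num.max; case: ltP => h1; case: ltP => h2; lra.
Qed.

Lemma cvg_maxr (R : realType) (T : Type) (F : set_system T) (f g : T -> R) (a b : R) :
  Filter F -> f x @[x --> F] --> a -> g x @[x --> F] --> b ->
  Num.max (f x) (g x) @[x --> F] --> Num.max a b.
Proof.
by move=> FF fa gb; apply: continuous2_cvg fa gb; exact: (@max_continuous _ R (a, b)).
Qed.

Lemma cvg_minr (R : realType) (T : Type) (F : set_system T) (f g : T -> R) (a b : R) :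
  Filter F -> f x @[x --> F] --> a -> g x @[x --> F] --> b ->
  Num.min (f x) (g x) @[x --> F] --> Num.min a b.
Proof.
by move=> FF fa gb; apply: continuous2_cvg fa gb; exact: (@min_continuous _ R (a, b)).
Qed.

(** * Exponential envelopes *)

Lemma open_metric_ball (R : realType) (X : metricType R) (x : X) (r : R) :
  open (ball x r).
Proof.
rewrite openE => y; rewrite ballEmdist/= => xy.
apply/metricType_numDomainType.nbhs_mdistP.
exists (r - mdist x y); first by rewrite /= subr_gt0.
by move=> z /= yz; have := metric_triangle x y z; rewrite ?ballEmdist/=; lra.
Qed.

Lemma measurable_metric_ball (R : realType) (X : polishMetricType R) (x : X) (r : R) :
  measurable (ball x r : set (borel X)).
Proof. by apply: open_borel; exact: open_metric_ball. Qed.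

Lemma null_dominates_ae d (T : measurableType d) (R : realType)
    (nu mu : {measure set T -> \bar R}) (P : T -> Prop) :
  nu `<< mu -> {ae mu, forall x, P x} -> {ae nu, forall x, P x}.
Proof.
move=> /null_content_dominatesP numu [N [mN muN PN]].
by exists N; split => //; exact: numu.
Qed.

Lemma measurable_expeR (R : realType) : measurable_fun setT (@expeR R).
Proof.
have -> : @expeR R = fun x => if x == +oo%E then +oo%E else
    if x == -oo%E then 0%E else (expR (fine x))%:E.
  by apply/funext => -[r| |].
apply: measurable_fun_ifT => //; first exact: measurable_fun_eqe.
apply: measurable_fun_ifT => //; first exact: measurable_fun_eqe.
by apply/measurable_EFinP; apply: measurableT_comp.
Qed.

Section exponential_envelope.
Context {R : realType} {X : polishMetricType R}.
Variables (mu : probability (borel X) R) (tau : X -> \bar R).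
Hypothesis mtau : measurable_fun (setT : set (borel X)) tau.
Hypothesis tau_ge0 : forall x, (0 <= tau x)%E.
Hypothesis tau_neq0 : mu [set x | tau x = 0%E] = 0%E.
Hypothesis tau_neqy : mu [set x | tau x = +oo%E] = 0%E.

(** Real-valued version of [tau], with value 0 on the null set where [tau] is infinite. *)
Definition rtau : borel X -> R := fun x => fine (tau x).

Local Notation t := rtau.

Lemma measurable_rtau : measurable_fun setT t.
Proof. exact: measurableT_comp. Qed.

Lemma rtau_ge0 x : 0 <= t x.
Proof. by rewrite fine_ge0. Qed.

Lemma ae_rtau : {ae mu, forall x, tau x = (t x)%:E /\ 0 < t x}.
Proof.
have m0 : measurable [set x : borel X | tau x = 0%E].
  by rewrite -[mkset _]setTI; exact: (mtau measurableT (emeasurable_set1 0%E)).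
have my : measurable [set x : borel X | tau x = +oo%E].
  by rewrite -[mkset _]setTI; exact: (mtau measurableT (emeasurable_set1 +oo%E)).
exists ([set x | tau x = 0%E] `|` [set x | tau x = +oo%E]); split.
- exact: measurableU.
- exact: null_set_setU.
move=> x; apply: contra_notP => /not_orP[] /= x0 xy.
have xf : tau x \is a fin_num by rewrite ge0_fin_numE// ltey; apply/eqP.
rewrite /rtau fineK//; split => //.
rewrite lt_neqAle rtau_ge0 andbT; apply/eqP => tx.
by apply: x0; rewrite -[tau x]fineK// -tx.
Qed.

Lemma expR_le_expeR (c : R) x : 0 <= c ->
  ((expR (t x * c))%:E <= expeR (c%:E * tau x))%E.
Proof.
rewrite le_eqVlt => /predU1P[<-|c0]; first by rewrite mulr0 mul0e/= expR0.
have := tau_ge0 x; rewrite /rtau; case: (tau x) => [r|_|//] /=.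
  by rewrite mulrC.
by rewrite gt0_muley ?lte_fin// leey.
Qed.

Lemma measurable_expR_tau (f : borel X -> R) : measurable_fun setT f ->
  measurable_fun setT (fun x => (expR (t x * f x))%:E).
Proof.
move=> mf; apply/measurable_EFinP; apply: measurableT_comp => //.
by apply: measurable_funM => //; exact: measurable_rtau.
Qed.

Lemma measurable_expeR_tau (c : R) :
  measurable_fun (setT : set (borel X)) (fun x => expeR (c%:E * tau x)).
Proof.
have h : measurable_fun (setT : set (borel X)) (fun x : borel X => (c%:E * tau x)%E).
  exact: measurable_funeM.
exact: (measurableT_comp (@measurable_expeR R) h).
Qed.

(* A test function cut off at an envelope keeps a finite exponential moment
   under Lusin approximation. *)
Definition envelope (w : borel X -> R) : Prop :=
  [/\ measurable_fun setT w, forall x, 0 <= w x, exists C, forall x, w x <= C,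
    exists wk : nat -> X -> R, [/\ forall k, continuous (wk k),
      forall k x, 0 <= wk k x <= w x &
      forall x, wk k x @[k --> \oo] --> w x] &
    (\int[mu]_x (expR (t x * w x))%:E < +oo)%E].

Lemma envelope0 : envelope (fun=> 0).
Proof.
split=> //; first by exists 0.
  exists (fun _ _ => 0); split => [k x|k x|x]; [exact: cvg_cst| |exact: cvg_cst].
  by rewrite lexx.
under eq_integral do rewrite mulr0 expR0.
by rewrite integral_cst// mul1e (le_lt_trans (probability_le1 mu measurableT))// ltry.
Qed.

Lemma envelope_max w1 w2 : envelope w1 -> envelope w2 ->
  envelope (fun x => Num.max (w1 x) (w2 x)).
Proof.
move=> [m1 w10 [C1 wC1] [v1 [cv1 v1w v1c]] i1] [m2 w20 [C2 wC2] [v2 [cv2 v2w v2c]] i2].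
have mm : measurable_fun setT (fun x => Num.max (w1 x) (w2 x)) by exact: measurable_maxr.
split; first exact: mm.
- by move=> x; rewrite le_max w10.
- exists (Num.max C1 C2) => x.
  by rewrite ge_max !le_max wC1 wC2 orbT.
- exists (fun k x => Num.max (v1 k x) (v2 k x)); split.
  + by move=> k; exact: continuous_maxr.
  + move=> k x; have /andP[a1 a2] := v1w k x; have /andP[b1 b2] := v2w k x.
    by rewrite le_max a1/= ge_max !le_max a2 b2 orbT.
  + by move=> x; exact: cvg_maxr.
(* The exponential of a maximum is at most the sum of the exponentials. *)
apply: (@le_lt_trans _ _ (\int[mu]_x ((expR (t x * w1 x))%:E + (expR (t x * w2 x))%:E))%E).
  apply: ge0_le_integral => //.
  - exact: measurable_expR_tau.
  - by apply: emeasurable_funD; exact: measurable_expR_tau.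
  - move=> x _; rewrite -EFinD lee_fin.
    by case: (leP (w1 x) (w2 x)) => _; rewrite ?lerDr ?lerDl expR_ge0.
by rewrite ge0_integralD//; [rewrite lte_add_pinfty|exact: measurable_expR_tau..].
Qed.

(** Openness of [U] is what lets continuous functions increase to the indicator. Off [U] the
    exponential is 1, so the moment is at most 1 plus the integral over [U]. *)
Lemma envelope_indic (U : set X) (c : R) : open U -> 0 <= c ->
  (\int[mu]_(x in U) expeR (c%:E * tau x) < +oo)%E ->
  envelope (fun x => c * \1_U x).
Proof.
move=> oU c0 iU; have [g [cg g01 Ug]] := open_bump oU.
have g0 x : 0 <= g x by case/andP: (g01 x).
have mU : measurable (U : set (borel X)) by exact: open_borel.
have mw : measurable_fun (setT : set (borel X)) (fun x => c * \1_U x).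
  by apply: measurable_funM => //; exact: measurable_indic.
split => //.
- by move=> x; rewrite mulr_ge0// indicE.
- by exists c => x; rewrite indicE ler_piMr//; case: (_ \in _).
- exists (fun k x => c * Num.min 1 (k%:R * g x)); split.
  + move=> k; apply: continuous_scale; apply: continuous_minr.
      by move=> x; exact: cvg_cst.
    exact: continuous_scale.
  + move=> k x; rewrite mulr_ge0//= ?le_min ?ler01 ?mulr_ge0// ler_wpM2l//.
    rewrite indicE; have [xU|xU] := boolP (x \in U); rewrite ge_min ?lexx//=.
    apply/orP; right; rewrite (_ : g x = 0) ?mulr0//.
    apply/eqP; rewrite eq_le g0 andbT leNgt; apply/negP => /Ug.
    by move/mem_set; apply/negP.
  + move=> x; apply: cvgM; first exact: cvg_cst.
    rewrite indicE; have [xU|xU] := boolP (x \in U).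
      have gx : 0 < g x by apply/Ug; rewrite inE in xU.
      apply/cvgrPdist_le => e e0; near=> k.
      suff -> : Num.min 1 (k%:R * g x) = 1 by rewrite subrr normr0 ltW.
      apply/min_idPl; rewrite -ler_pdivrMr// mul1r; near: k.
      exact: nbhs_infty_ger.
    have -> : g x = 0.
      apply/eqP; rewrite eq_le g0 andbT leNgt; apply/negP => /Ug.
      by move/mem_set; apply/negP.
    under eq_fun do rewrite mulr0 min_r//.
    exact: cvg_cst.
apply: (@le_lt_trans _ _ (\int[mu]_x (1 + ((fun x => expeR (c%:E * tau x)) \_ U) x))%E).
  have me : measurable_fun (setT : set (borel X)) ((fun x => expeR (c%:E * tau x)) \_ U).
    by apply/(measurable_restrictT _ mU); apply: measurable_funTS; exact: measurable_expeR_tau.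
  apply: ge0_le_integral => //.
  - exact: measurable_expR_tau.
  - exact: emeasurable_funD.
  - move=> x _; rewrite patchE indicE; case: ifPn => xU /=.
      by rewrite mulr1 (le_trans (expR_le_expeR x c0))// leeDr.
    by rewrite !mulr0 expR0 adde0.
rewrite ge0_integralD//; last 2 first.
- by move=> x _; apply: erestrict_ge0 => y _; exact: expeR_ge0.
- by apply/(measurable_restrictT _ mU); apply: measurable_funTS; exact: measurable_expeR_tau.
rewrite integral_cst// mul1e -integral_mkcond lte_add_pinfty//.
by rewrite (le_lt_trans (probability_le1 mu measurableT))// ltry.
Unshelve. all: by end_near. Qed.

(** A ball that contains [x] contains a smaller one centred at [x]. Bounds on [xi] can thus be read
    from balls with any centre, in particular a centre in a countable dense set. *)
Lemma xi_ge (x y : X) (r c : R) : ball y r x -> 0 <= c ->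
  (\int[mu]_(z in ball y r) expeR (c%:E * tau z) < +oo)%E ->
  (c%:E <= xi mu tau x)%E.
Proof.
move=> Byx c0 ir; pose s := r - mdist y x.
have s0 : 0 < s by rewrite subr_gt0; move: Byx; rewrite ballEmdist.
have sr : ball x s `<=` ball y r.
  move=> z; rewrite !ballEmdist/= /s => xz.
  by have := metric_triangle y x z; lra.
apply: (@le_trans _ _ (exp_rate mu tau (ball x s))); last first.
  by apply: ereal_sup_ubound; exists s.
apply: ereal_sup_ubound; exists c => //; split => //.
apply: le_lt_trans ir; apply: ge0_subset_integral => //.
- exact: (measurable_metric_ball x s).
- exact: (measurable_metric_ball y r).
- by apply: measurable_funTS; exact: measurable_expeR_tau.
- by move=> z _; exact: expeR_ge0.
Qed.

Lemma xi_gt (x : X) (c : R) : 0 <= c -> (c%:E < xi mu tau x)%E ->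
  exists c' r : R, [/\ c < c', 0 < r &
    (\int[mu]_(z in ball x r) expeR (c'%:E * tau z) < +oo)%E].
Proof.
move=> c0 /ereal_sup_gt[_ [r r0 <-]] /ereal_sup_gt[_ [c' [c'0 ic] <-]].
by rewrite lte_fin => cc'; exists c', r.
Qed.

Lemma xi_ge0 x : (0 <= xi mu tau x)%E.
Proof.
apply: (@xi_ge x x 1 0) => //; first by rewrite ballEmdist/= mdistxx.
under eq_integral do rewrite mul0e expeR0.
rewrite integral_cst ?mul1e; last exact: (measurable_metric_ball x 1).
by rewrite (le_lt_trans (probability_le1 _ _)) ?ltry//; exact: (measurable_metric_ball x 1).
Qed.

(* The suprema defining [xi] may be restricted to balls with centre in a
   countable dense set, inverse integer radius and rational exponent. *)
Lemma xi_envelope : exists w : nat -> borel X -> R, [/\ forall n, envelope (w n),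
  forall x, nondecreasing_seq (w^~ x) &
  forall x, (w n x)%:E @[n --> \oo] --> xi mu tau x].
Proof.
have [D cD dD] := @separableT R X.
have [z Dz] : D !=set0.
  by have [z [_ Dz]] := dD setT (ex_intro _ point I) openT; exists z.
have [d Dd] : exists d : nat -> X, D `<=` range d.
  have [D0|[d]] := pfcard_geP cD; first by move: Dz; rewrite D0.
  by exists d; exact: surj.
pose good (i : nat * nat * rat) := (0 <= ratr i.2 :> R) /\
  (\int[mu]_(y in ball (d i.1.1) (i.1.2.+1%:R^-1)) expeR ((ratr i.2)%:E * tau y) < +oo)%E.
pose a (i : nat * nat * rat) : borel X -> R := if `[< good i >] then
  fun x => ratr i.2 * \1_(ball (d i.1.1) (i.1.2.+1%:R^-1)) x else fun=> 0.
have ea i : envelope (a i).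
  rewrite /a; case: ifPn => [/asboolP[i0 ii]|_]; last exact: envelope0.
  by apply: envelope_indic => //; exact: open_metric_ball.
have axi i x : ((a i x)%:E <= xi mu tau x)%E.
  rewrite /a; case: ifPn => [/asboolP[i0 ii]|_]; last exact: xi_ge0.
  rewrite indicE; have [xB|xB] := boolP (x \in _); last by rewrite mulr0 xi_ge0.
  by rewrite mulr1; apply: xi_ge ii => //; rewrite inE in xB.
pose b n : borel X -> R := if unpickle n is Some i then a i else fun=> 0.
have eb n : envelope (b n) by rewrite /b; case: unpickle => //; exact: envelope0.
have bxi n x : ((b n x)%:E <= xi mu tau x)%E.
  by rewrite /b; case: unpickle => //; exact: xi_ge0.
(* Running maxima of the enumerated envelopes make the sequence monotone. *)
pose w := fix w n : borel X -> R :=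
  if n is m.+1 then fun x => Num.max (w m x) (b m x) else fun=> 0.
have ew n : envelope (w n).
  by elim: n => [|n IH]; [exact: envelope0|exact: envelope_max].
have wxi n x : ((w n x)%:E <= xi mu tau x)%E.
  elim: n => [|n IH]; first exact: xi_ge0.
  by rewrite /= EFin_max ge_max IH bxi.
have bw n x : b n x <= w n.+1 x by rewrite /= le_max lexx orbT.
have ndw x : nondecreasing_seq (w^~ x).
  by apply/nondecreasing_seqP => n; rewrite /= le_max lexx.
exists w; split => // x.
suff <- : ereal_sup (range (fun n => (w n x)%:E)) = xi mu tau x.
  by apply: ereal_nondecreasing_cvgn => m n mn; rewrite lee_fin ndw.
apply/eqP; rewrite eq_le; apply/andP; split.
  by apply: ge_ereal_sup => _ [n _ <-].
rewrite leNgt; apply/negP; set s := ereal_sup _ => sxi.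
have s0 : (0 <= s)%E by apply: ereal_sup_ubound; exists 0.
have sfin : s \is a fin_num by rewrite ge0_fin_numE// (lt_le_trans sxi)// leey.
have s0' : 0 <= fine s by rewrite fine_ge0.
have [] := @xi_gt x (fine s) s0'; first by rewrite fineK.
move=> c [r [sc r0 ic]].
have [q] := rat_in_itvoo sc; rewrite in_itv/= => /andP[sq qc].
have q0 : 0 <= ratr q :> R by rewrite (le_trans s0')// ltW.
(* A ball of radius at most r/2 that contains [x] lies inside [ball x r], so the exponential moment
   over it is finite too. *)
have [k kr] : exists k : nat, k.+1%:R^-1 <= r / 2.
  exists (Num.truncn (r / 2)^-1).
  by rewrite -[leRHS]invrK lef_pV2 ?posrE ?invr_gt0 ?divr_gt0//; exact/ltW/truncnS_gt.
have [y [xy Dy]] : ball x k.+1%:R^-1 `&` D !=set0.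
  apply: dD; last exact: open_metric_ball.
  by exists x; rewrite ballEmdist/= mdistxx.
have [j _ dj] := Dd _ Dy.
have gq : good (j, k, q).
  split => //=; apply: le_lt_trans ic.
  apply: (@le_trans _ _ (\int[mu]_(u in ball x r) expeR ((ratr q)%:E * tau u))%E).
    apply: ge0_subset_integral => //.
    - exact: (measurable_metric_ball (d j) k.+1%:R^-1).
    - exact: (measurable_metric_ball x r).
    - by apply: measurable_funTS; exact: measurable_expeR_tau.
    - by move=> u _; exact: expeR_ge0.
    move=> u /=; move: xy; rewrite dj !ballEmdist/= => xy yu.
    have := metric_triangle x y u; move: xy yu kr; set e := k.+1%:R^-1.
    by move=> xy yu kr xyu; lra.
  apply: ge0_le_integral => //.
  - exact: (measurable_metric_ball x r).
  - by move=> u _; exact: expeR_ge0.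
  - by apply: measurable_funTS; exact: measurable_expeR_tau.
  - by apply: measurable_funTS; exact: measurable_expeR_tau.
  - by move=> u _; rewrite lee_expeR lee_wpmul2r// lee_fin ltW.
have : b (pickle (j, k, q)) x <= fine s.
  rewrite -lee_fin fineK// (@le_trans _ _ (w (pickle (j, k, q)).+1 x)%:E)//.
    by rewrite lee_fin.
  by apply: ereal_sup_ubound; exists (pickle (j, k, q)).+1.
rewrite /b pickleK /a asboolT//= indicE mem_set ?mulr1 ?leNgt ?sq//.
by rewrite dj; apply: ball_sym.
Qed.

End exponential_envelope.

(** * The functional dominates its test functions *)

Lemma ae_imp d (T : measurableType d) (R : realType)
    (m : {measure set T -> \bar R}) (P Q : T -> Prop) :
  {ae m, forall x, P x} -> (forall x, P x -> Q x) -> {ae m, forall x, Q x}.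
Proof. by move=> mP PQ; apply: filterS mP => x; exact: PQ. Qed.

Lemma lebesgue_decompositionP d (T : measurableType d) (R : realType)
    (nu : probability T R) (mu : {measure set T -> \bar R}) :
  is_lebesgue_decomposition nu mu (ac_part nu mu, singular_part nu mu).
Proof. by rewrite /ac_part /singular_part -surjective_pairing; exact: svalP. Qed.

Lemma integral_lebesgue_decomposition d (T : measurableType d) (R : realType)
    (nu : probability T R) (mu : {measure set T -> \bar R}) (g : T -> \bar R) :
  measurable_fun setT g -> (forall x, 0 <= g x)%E ->
  (\int[nu]_x g x = \int[ac_part nu mu]_x g x + \int[singular_part nu mu]_x g x)%E.
Proof.
move=> mg g0; rewrite -ge0_integral_measure_add//.
apply: eq_measure_integral => A mA _; have [_ _ h] := lebesgue_decompositionP nu mu.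
by rewrite /= /msum 2!big_ord_recl/= big_ord0 adde0; exact: h.
Qed.

(** Young's inequality rho u + 1 <= h(rho) + e^u is integrated against [mu]; the 1 on the left
    cancels the bound on the integral of e^u. The negative part of [u] is moved to the right because
    neither part is known to be integrable. *)
Lemma entropy_duality d (T : measurableType d) (R : realType)
    (nu mu : probability T R) (u : T -> R) :
  measurable_fun setT u -> nu `<< mu -> (\int[mu]_x (expR (u x))%:E <= 1)%E ->
  (\int[nu]_x (Num.max (u x) 0)%:E <=
    relative_entropy nu mu + \int[nu]_x (Num.max (- u x) 0)%:E)%E.
Proof.
move=> mu_ numu iu.
have [rho [mrho rho0 rhoE ->]] := relative_entropy_density numu.
have mp : measurable_fun setT (fun x => (Num.max (u x) 0)%:E).
  by apply/measurable_EFinP; exact: measurable_maxr.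
have mn : measurable_fun setT (fun x => (Num.max (- u x) 0)%:E).
  by apply/measurable_EFinP; apply: measurable_maxr => //; exact: measurableT_comp.
have p0 x : (0 <= (Num.max (u x) 0)%:E)%E by rewrite lee_fin le_max lexx orbT.
have n0 x : (0 <= (Num.max (- u x) 0)%:E)%E by rewrite lee_fin le_max lexx orbT.
have mr : measurable_fun setT (EFin \o rho) by exact/measurable_EFinP.
have mprho : measurable_fun setT (fun x => (Num.max (u x) 0)%:E * (rho x)%:E)%E.
  exact: emeasurable_funM.
have mnrho : measurable_fun setT (fun x => (Num.max (- u x) 0)%:E * (rho x)%:E)%E.
  exact: emeasurable_funM.
have mh : measurable_fun setT (fun x => (entropy_fun (rho x))%:E).
  by apply/measurable_EFinP; exact: (measurableT_comp (@measurable_entropy_fun R)).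
have me : measurable_fun setT (fun x => (expR (u x))%:E).
  by apply/measurable_EFinP; exact: measurableT_comp.
rewrite !rhoE//.
have pr0 x : (0 <= (Num.max (u x) 0)%:E * (rho x)%:E)%E.
  by rewrite mule_ge0// lee_fin.
have nr0 x : (0 <= (Num.max (- u x) 0)%:E * (rho x)%:E)%E.
  by rewrite mule_ge0// lee_fin.
have h0 x : (0 <= (entropy_fun (rho x))%:E)%E by rewrite lee_fin entropy_fun_ge0.
rewrite -(leeD2rE (x := 1%E))//.
apply: (@le_trans _ _ (\int[mu]_x (entropy_fun (rho x))%:E +
    \int[mu]_x ((Num.max (- u x) 0)%:E * (rho x)%:E) +
    \int[mu]_x (expR (u x))%:E)%E); last exact: leeD2l.
have hn0 x : (0 <= (entropy_fun (rho x))%:E + (Num.max (- u x) 0)%:E * (rho x)%:E)%E.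
  by rewrite adde_ge0.
have mhn : measurable_fun setT
    (fun x => (entropy_fun (rho x))%:E + (Num.max (- u x) 0)%:E * (rho x)%:E)%E.
  exact: emeasurable_funD.
have i1 : (\int[mu]_x (cst 1%E x) = 1)%E.
  by rewrite integral_cst// mul1e; exact: probability_setT.
rewrite -ge0_integralD// -ge0_integralD// -[X in (_ + X <= _)%E]i1 -ge0_integralD//.
apply: ge0_le_integral => //.
- by move=> x _; rewrite adde_ge0.
- exact: emeasurable_funD.
- exact: emeasurable_funD.
move=> x _; have hy := entropy_fun_young (u x) (rho0 x).
rewrite -!EFinM -!EFinD lee_fin; case: (leP 0 (u x)) => u0.
  by rewrite max_r ?oppr_le0// mul0r; lra.
by rewrite max_l ?oppr_ge0 ?(ltW u0)// !mul0r; lra.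
Qed.

Section rate_upper.
Context {R : realType} {X : polishMetricType R}.
Variables (mu : probability (borel X) R) (tau : X -> \bar R).
Hypothesis mtau : measurable_fun (setT : set (borel X)) tau.
Hypothesis tau_ge0 : forall x, (0 <= tau x)%E.
Hypothesis tau_neq0 : mu [set x | tau x = 0%E] = 0%E.
Hypothesis tau_neqy : mu [set x | tau x = +oo%E] = 0%E.

Local Notation t := (rtau tau).

Definition test_fun (f : X -> R) : Prop :=
  Cb f /\ (\int[mu]_x (expR (t x * f x))%:E <= 1)%E.

(** The measure nu_a / tau before normalization; its total mass is the factor of the entropy in
    [rate_functional]. *)
Definition tilt (nu : probability (borel X) R) : {measure set (borel X) -> \bar R} :=
  mdensity (ac_part nu mu) (measurable_inv_tau mtau tau_ge0) (inv_tau_ge0 tau_ge0).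

Lemma measurable_xi : measurable_fun (setT : set (borel X)) (xi mu tau).
Proof.
have [w [ew _ wc]] := xi_envelope mu mtau tau_ge0.
apply: (emeasurable_fun_cvg (fun n x => (w n x)%:E)) => // n.
by apply/measurable_EFinP; case: (ew n).
Qed.

Variable nu : probability (borel X) R.

Local Notation na := (ac_part nu mu).
Local Notation ns := (singular_part nu mu).
Local Notation kappa := (tilt nu).

Lemma ac_part_dominated : na `<< mu.
Proof. by case: (lebesgue_decompositionP nu mu). Qed.

Lemma ae_ac_rtau : {ae na, forall x, tau x = (t x)%:E /\ 0 < t x}.
Proof. by apply: null_dominates_ae ac_part_dominated _; exact: ae_rtau. Qed.

Let mt : measurable_fun setT t. Proof. exact: measurable_rtau. Qed.

Lemma measurable_rtauV : measurable_fun (setT : set (borel X)) (fun x => (t x)^-1).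
Proof.
rewrite (_ : (fun x => _) = fun x => (t x) `^ (-1)); last first.
  by apply/funext => x; rewrite powR_inv1// rtau_ge0.
exact: (measurableT_comp (measurable_powR _)).
Qed.

Let mtV := measurable_rtauV.

Lemma integral_tilt (g : borel X -> \bar R) : measurable_fun setT g ->
  (forall x, 0 <= g x)%E -> (\int[kappa]_x g x = \int[na]_x (g x * ((t x)^-1)%:E))%E.
Proof.
move=> mg g0; apply: integral_density => //.
  by move=> x; rewrite invr_ge0 rtau_ge0.
move=> A mA; apply: ge0_ae_eq_integral => //.
- by apply: measurable_funTS; exact: measurable_inv_tau.
- by apply/measurable_EFinP; exact: measurable_funTS.
- by move=> x _; exact: inv_tau_ge0.
- by move=> x _; rewrite lee_fin invr_ge0 rtau_ge0.
apply: (ae_imp ae_ac_rtau) => x [tx t0] _; rewrite /inv_tau tx.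
by rewrite inver gt_eqF.
Qed.

(** The weight [t] cancels the density 1/tau almost everywhere. This converts nu_a(f) into the
    integral of t f against the tilt, which is the form that entropy duality takes. *)
Lemma integral_tilt_rtau (f : borel X -> R) : measurable_fun setT f ->
  (forall x, 0 <= f x) ->
  (\int[kappa]_x (t x * f x)%:E = \int[na]_x (f x)%:E)%E.
Proof.
move=> mf f0; rewrite integral_tilt; first last.
- by move=> x; rewrite lee_fin mulr_ge0// rtau_ge0.
- by apply/measurable_EFinP; exact: measurable_funM.
apply: ge0_ae_eq_integral => //.
- by apply/measurable_EFinP; apply: measurable_funM => //; exact: measurable_funM.
- exact/measurable_EFinP.
- by move=> x _; rewrite -EFinM lee_fin !mulr_ge0 ?invr_ge0// rtau_ge0.
- by move=> x _; rewrite lee_fin.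
apply: (ae_imp ae_ac_rtau) => x [tx t0] _.
by rewrite -EFinM mulrAC divff ?mul1r// gt_eqF.
Qed.

Lemma tilt_dominated : kappa `<< mu.
Proof.
apply/null_content_dominatesP => A mA muA.
have /null_content_dominatesP h := ac_part_dominated.
by apply: null_set_integral; [|apply: measurable_funTS; exact: measurable_inv_tau|exact: h].
Qed.

Section normalized.
Variable z : R.
Hypotheses (z0 : 0 < z) (zE : kappa setT = z%:E).

Let P := ac_tilt mu mtau tau_ge0 nu.

Let PE (A : set (borel X)) : P A = (kappa A * z^-1%:E)%E.
Proof.
rewrite /P /ac_tilt/= /mnormalize [in X in X _](zE : _ = _)/=.
by rewrite eqe gt_eqF.
Qed.

Lemma ac_tilt_dominated : P `<< mu.
Proof.
apply/null_content_dominatesP => A mA muA.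
by rewrite PE ((null_content_dominatesP _ _).1 tilt_dominated A mA muA) mul0e.
Qed.

Lemma integral_ac_tilt (g : borel X -> \bar R) : measurable_fun setT g ->
  (forall x, 0 <= g x)%E -> (z%:E * \int[P]_x g x = \int[kappa]_x g x)%E.
Proof.
move=> mg g0; rewrite (@integral_density _ _ _ P kappa (fun=> z^-1))//.
- rewrite ge0_integralZr//; last by rewrite lee_fin invr_ge0 ltW.
  by rewrite muleCA -EFinM divff ?gt_eqF// mule1.
- by move=> x; rewrite invr_ge0 ltW.
- by move=> A mA; rewrite integral_cst// muleC; exact: PE.
Qed.

End normalized.

Let pp0 (r : R) : 0 <= Num.max r 0. Proof. by rewrite le_max lexx orbT. Qed.

(** If xi(x) < c < f(x), then f > c on a ball around [x] by continuity. There e^(c tau) <= e^(t f)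
    almost everywhere, so the moment at [c] is finite and c <= xi(x), a contradiction. *)
Lemma test_fun_le_xi f x : test_fun f -> ((f x)%:E <= xi mu tau x)%E.
Proof.
move=> [Cf itf]; have [cf _] := Cf.
have xi0 : (0 <= xi mu tau x)%E by exact: xi_ge0.
rewrite leNgt; apply/negP => xif.
have xfin : xi mu tau x \is a fin_num by rewrite ge0_fin_numE// (lt_trans xif)// ltry.
pose s := fine (xi mu tau x); have sE : xi mu tau x = s%:E by rewrite fineK.
have s0 : 0 <= s by rewrite fine_ge0.
have sf : s < f x by rewrite -lte_fin -sE.
pose c := (s + f x) / 2; have sc : s < c by rewrite /c; lra.
have cfx : c < f x by rewrite /c; lra.
have [e e0 efc] : exists2 e : R, 0 < e & ball x e `<=` [set y | c < f y].
  have : nbhs x [set y | c < f y].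
    apply: open_nbhs_nbhs; split => //.
    rewrite (_ : mkset _ = f @^-1` [set r | c < r])//.
    by move/continuousP: cf; apply; exact: open_gt.
  move/metricType_numDomainType.nbhs_mdistP => [e /= e0 eU].
  by exists e => // y; rewrite ballEmdist; exact: eU.
suff : (c%:E <= xi mu tau x)%E by rewrite sE lee_fin leNgt sc.
apply: (@xi_ge _ _ mu tau mtau x x e c) => //.
- by rewrite ballEmdist/= mdistxx.
- by rewrite (le_trans s0)// ltW.
have mB : measurable (ball x e : set (borel X)) by exact: (measurable_metric_ball x e).
have mf := continuous_borel cf.
apply: (@le_lt_trans _ _ (\int[mu]_(y in ball x e) (expR (t y * f y))%:E)%E).
  apply: ae_ge0_le_integral => //.
  - by move=> y _; exact: expeR_ge0.
  - by apply: measurable_funTS; exact: measurable_expeR_tau.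
  - by apply: measurable_funTS; exact: measurable_expR_tau.
  apply: (ae_imp (ae_rtau mtau tau_ge0 tau_neq0 tau_neqy)).
  move=> y [ty t0] /efc /= cy; rewrite ty -EFinM /= lee_fin ler_expR.
  by rewrite mulrC ler_pM2l// ltW.
apply: (@le_lt_trans _ _ (\int[mu]_y (expR (t y * f y))%:E)%E).
  by apply: ge0_subset_integral => //; exact: measurable_expR_tau.
by rewrite (le_lt_trans itf)// ltry.
Qed.

Lemma rate_functional_ge (f : X -> R) (M : R) : test_fun f ->
  (rate_functional mu mtau tau_ge0 nu <= M%:E)%E -> Rintegral nu setT f <= M.
Proof.
move=> tf; have [Cf itf] := tf; have [cf [C fC]] := Cf.
have mf : measurable_fun (setT : set (borel X)) f by exact: continuous_borel.
have mp : measurable_fun (setT : set (borel X)) (fun x => Num.max (f x) 0).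
  exact: measurable_maxr.
have mn : measurable_fun (setT : set (borel X)) (fun x => Num.max (- f x) 0).
  by apply: measurable_maxr => //; exact: measurableT_comp.
rewrite /rate_functional; set Z := (\int[na]_x _)%E; set S := (\int[ns]_x _)%E.
have ZE : Z = kappa setT by [].
case: ifPn => [Zoo|_]; last by rewrite leye_eq.
have sing : (\int[ns]_x (Num.max (f x) 0)%:E <= S)%E.
  apply: ge0_le_integral => //.
  - by move=> x _; rewrite lee_fin.
  - exact/measurable_EFinP.
  - exact: measurable_xi.
  - move=> x _; rewrite EFin_max ge_max test_fun_le_xi//.
    exact: xi_ge0.
set E := (X in (X + S)%E).
have ac : (\int[na]_x (Num.max (f x) 0)%:E <= E + \int[na]_x (Num.max (- f x) 0)%:E)%E.
  rewrite -(integral_tilt_rtau mp)// -(integral_tilt_rtau mn)//.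
  (* A tilt of mass 0 annihilates the left side, in accordance with the value 0 of the entropy
     term. *)
  have [Z0|Z0] := eqVneq Z 0%E.
    have k0 (g : borel X -> \bar R) : measurable_fun setT g -> (\int[kappa]_x g x = 0)%E.
      by move=> mg; apply: null_set_integral => //; rewrite -ZE.
    rewrite /E Z0 eqxx k0 ?add0e.
      by apply: integral_ge0 => x _; rewrite lee_fin mulr_ge0// rtau_ge0.
    by apply/measurable_EFinP; exact: measurable_funM.
  have Zfin : Z \is a fin_num by rewrite ge0_fin_numE// ZE measure_ge0.
  have z0 : 0 < fine Z by rewrite fine_gt0// Zoo andbT lt0e Z0 ZE measure_ge0.
  have zE : kappa setT = (fine Z)%:E by rewrite fineK.
  rewrite /E (negbTE Z0) -(fineK Zfin).
  rewrite -!(integral_ac_tilt z0 zE); first last.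
  - by move=> x; rewrite lee_fin mulr_ge0// rtau_ge0.
  - by apply/measurable_EFinP; exact: measurable_funM.
  - by move=> x; rewrite lee_fin mulr_ge0// rtau_ge0.
  - by apply/measurable_EFinP; exact: measurable_funM.
  rewrite -muleDr; last first.
    by apply: ge0_adde_def; rewrite inE ?relative_entropy_ge0//;
      apply: integral_ge0 => x _; rewrite lee_fin mulr_ge0// rtau_ge0.
    by [].
  apply: lee_wpmul2l; first by rewrite lee_fin ltW.
  have mtf : measurable_fun (setT : set (borel X)) (fun x => t x * f x) by exact: measurable_funM.
  have := entropy_duality mtf (ac_tilt_dominated z0 zE) itf.
  have pE x : t x * Num.max (f x) 0 = Num.max (t x * f x) 0.
    by rewrite maxr_pMr ?mulr0// rtau_ge0.
  have nE x : t x * Num.max (- f x) 0 = Num.max (- (t x * f x)) 0.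
    by rewrite maxr_pMr ?mulr0 ?mulrN// rtau_ge0.
  by under [X in _ -> (X <= _)%E]eq_integral do rewrite pE;
     under [X in _ -> (_ <= _ + X)%E]eq_integral do rewrite nE.
move=> ISM; have [a [b [aE bE ->]]] := Rintegral_pos_neg nu mf fC.
rewrite lerBlDr -lee_fin EFinD -aE -bE.
have dec (g : borel X -> R) : measurable_fun setT g -> (forall x, 0 <= g x) ->
    (\int[nu]_x (g x)%:E = \int[na]_x (g x)%:E + \int[ns]_x (g x)%:E)%E.
  move=> mg g0; apply: integral_lebesgue_decomposition => //.
  exact/measurable_EFinP.
rewrite (dec _ mp)// (dec _ mn)//.
(* The negative part of [f] under the singular part only helps and is discarded. *)
apply: (@le_trans _ _ ((E + S) + \int[na]_x (Num.max (- f x) 0)%:E)%E).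
  by rewrite [leRHS]addeAC; exact: leeD ac sing.
apply: leeD => //; rewrite leeDl//.
by apply: integral_ge0 => x _; rewrite lee_fin.
Qed.

End rate_upper.

(** * The test functions determine the functional *)

Lemma ae_monotone_cvg d (T : measurableType d) (R : realType)
    (m : {measure set T -> \bar R}) (g_ : nat -> T -> \bar R) (g : T -> \bar R) :
  (forall n, measurable_fun setT (g_ n)) -> (forall n x, 0 <= g_ n x)%E ->
  (forall x, nondecreasing_seq (g_^~ x)) ->
  measurable_fun setT g -> (forall x, 0 <= g x)%E ->
  {ae m, forall x, g_ n x @[n --> \oo] --> g x} ->
  (\int[m]_x g_ n x @[n --> \oo] --> \int[m]_x g x)%E.
Proof.
move=> mg_ g_0 ndg mg g0 gcvg.
have g_cvg x : cvgn (g_^~ x) by exact: ereal_nondecreasing_is_cvgn.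
have mlim : measurable_fun setT (fun x => limn (g_^~ x)).
  by apply: (emeasurable_fun_cvg g_) => // x _; exact: g_cvg.
have -> : (\int[m]_x g x = \int[m]_x limn (g_^~ x))%E.
  apply: ge0_ae_eq_integral => //.
    by move=> x _; apply: lime_ge => //; exact: nearW.
  by apply: (ae_imp gcvg) => x gx _; apply/esym/cvg_lim.
by apply: cvg_monotone_convergence => // x _; exact: ndg.
Qed.

Lemma cvge_lt (R : realType) (T : Type) (F : set_system T) (f : T -> \bar R)
    (a b : \bar R) : Filter F -> f x @[x --> F] --> a -> (a < b)%E ->
  \forall x \near F, (f x < b)%E.
Proof.
move=> FF fa ab; exact: (fa [set y | (y < b)%E] (open_ereal_lt' ab)).
Qed.

Section bounded_limits.
Context {R : realType}.

Lemma clampK (n y : R) : `|y| <= n -> Num.max (- n) (Num.min n y) = y.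
Proof. by rewrite ler_norml => /andP[h1 h2]; rewrite min_r// max_r. Qed.

Lemma norm_clamp (n y : R) : 0 <= n -> `|Num.max (- n) (Num.min n y)| <= n.
Proof.
move=> n0; rewrite ler_norml le_max lexx/= ge_max ge_min lexx/= andbT.
by rewrite (le_trans _ n0)// oppr_le0.
Qed.

Lemma norm_clamp_le (n y : R) : 0 <= n ->
  `|Num.max (- n) (Num.min n y)| <= `|y|.
Proof.
move=> n0; have h1 := ler_norm y; have := ler_norm (- y); rewrite normrN ler_norml.
move: h1; set t := `|_| => h1 h2.
case: (leP n y) => h3; [case: (leP (- n) n)|case: (leP (- n) y)] => h4;
  by apply/andP; split; lra.
Qed.

Lemma pos_clamp (n y : R) : 0 <= n ->
  Num.max (Num.max (- n) (Num.min n y)) 0 = Num.min n (Num.max y 0).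
Proof.
move=> n0; case: (leP y 0) => y0.
  rewrite (min_r n0) (min_r (le_trans y0 n0)).
  by case: (leP (- n) y) => h; rewrite max_r// oppr_le0.
by case: (leP n y) => h; rewrite (max_r (_ : - n <= _)) ?max_l//; lra.
Qed.

Lemma neg_clamp (n y : R) : 0 <= n ->
  Num.max (- Num.max (- n) (Num.min n y)) 0 = Num.min n (Num.max (- y) 0).
Proof.
move=> n0; case: (leP 0 y) => y0.
  have m0 : 0 <= Num.min n y by rewrite le_min n0.
  rewrite (max_r (le_trans _ m0)) ?oppr_le0// max_r ?oppr_le0//.
  by rewrite max_r ?oppr_le0// min_r.
rewrite (min_r (le_trans (ltW y0) n0)) oppr_max opprK.
rewrite [Num.max (- y) 0]max_l ?oppr_ge0 ?(ltW y0)//.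
by rewrite max_l// le_min n0 oppr_ge0 ltW.
Qed.

End bounded_limits.

Section rate_lower.
Context {R : realType} {X : polishMetricType R}.
Variables (mu : probability (borel X) R) (tau : X -> \bar R).
Hypothesis mtau : measurable_fun (setT : set (borel X)) tau.
Hypothesis tau_ge0 : forall x, (0 <= tau x)%E.
Hypothesis tau_neq0 : mu [set x | tau x = 0%E] = 0%E.
Hypothesis tau_neqy : mu [set x | tau x = +oo%E] = 0%E.
Hypothesis xi_eqy : mu [set x | (xi mu tau x < +oo)%E] = 0%E.
Variables (nu : probability (borel X) R) (M : R).
Hypothesis nuM : forall f, test_fun mu tau f -> Rintegral nu setT f <= M.

Local Notation t := (rtau tau).
Local Notation na := (ac_part nu mu).
Local Notation ns := (singular_part nu mu).
Local Notation kappa := (tilt mu mtau tau_ge0 nu).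

Let mt : measurable_fun setT t. Proof. exact: measurable_rtau. Qed.

Let pp0 (r : R) : 0 <= Num.max r 0. Proof. by rewrite le_max lexx orbT. Qed.

(** The approximants are cut at the continuous functions [wk k]. Being below [w], they have
    exponentials dominated by e^(t w), and the cut does not disturb the limit since u <= w. *)
Lemma envelope_bound (u w : borel X -> R) (C : R) : measurable_fun setT u ->
  (forall x, `|u x| <= C) -> envelope mu tau w -> (forall x, u x <= w x) ->
  (\int[mu]_x (expR (t x * u x))%:E < 1)%E -> Rintegral nu setT u <= M.
Proof.
move=> mfu uC [mw w0 _ [wk [cwk wkw wkc]] iw] uw iu.
(* Lusin approximations with respect to the average of [mu] and [nu] converge
   almost everywhere for both. *)
have h0 : 0 < 2^-1 :> R by [].
have h1 : 0 < 1 - 2^-1 :> R by lra.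
have h2 : 2^-1 <= 1 :> R by lra.
pose m : probability (borel X) R := mixture (Itv01 (ltW h0) h2) mu nu.
have mE A : m A = ((2^-1)%:E * mu A + (1 - 2^-1)%:E * nu A)%E by [].
have mmu : mu `<< m.
  apply/null_content_dominatesP => A mA mA0; apply/eqP.
  rewrite eq_le measure_ge0 andbT -(@lee_pmul2l _ (2^-1)%:E)// mule0.
  rewrite -(etrans (esym (mE A)) mA0) leeDl//.
  by rewrite mule_ge0// lee_fin ltW.
have mnu : nu `<< m.
  apply/null_content_dominatesP => A mA mA0; apply/eqP.
  rewrite eq_le measure_ge0 andbT -(@lee_pmul2l _ (1 - 2^-1)%:E)// mule0.
  rewrite -(etrans (esym (mE A)) mA0) leeDr//.
  by rewrite mule_ge0// lee_fin ltW.
have [f [cf fC fu]] := lusin_seq m mfu uC.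
pose g k x := Num.min (f k x) (wk k x).
have cg k : continuous (g k) by exact: continuous_minr.
have mg k : measurable_fun (setT : set (borel X)) (g k) by exact: continuous_borel.
have gC k x : `|g k x| <= C.
  have /andP[wk0 _] := wkw k x; have := fC k x; rewrite !ler_norml => /andP[f1 f2].
  by rewrite le_min ge_min f1 f2 /= andbT; lra.
have gw k x : g k x <= w x.
  by rewrite /g ge_min; have /andP[_ ->] := wkw k x; rewrite orbT.
have gu : {ae m, forall x, g k x @[k --> \oo] --> u x}.
  apply: (ae_imp fu) => x fx; rewrite -[X in _ --> X](min_idPl (uw x)).
  exact: cvg_minr fx (wkc x).
(* The limit of the moments is strictly below 1, so the moments themselves are eventually below
   1. *)
have tg : \forall k \near \oo, test_fun mu tau (g k).
  have [_ _] : [/\ mu.-integrable setT (fun x => (expR (t x * u x))%:E),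
      (\int[mu]_x `|(expR (t x * g k x))%:E - (expR (t x * u x))%:E| @[k --> \oo] --> 0)%E &
      (\int[mu]_x (expR (t x * g k x))%:E @[k --> \oo] -->
        \int[mu]_x (expR (t x * u x))%:E)%E].
    apply: (@dominated_convergence _ _ _ mu _ measurableT
      (fun k x => (expR (t x * g k x))%:E) _ (fun x => (expR (t x * w x))%:E)).
    - by move=> k; exact: measurable_expR_tau.
    - exact: measurable_expR_tau.
    - apply: (ae_imp (null_dominates_ae mmu gu)) => x gx _.
      apply: cvg_EFin; first exact: nearW.
      have h : t x * g k x @[k --> \oo] --> t x * u x.
        by apply: cvgM gx; exact: cvg_cst.
      exact: (cvg_comp _ _ h (@continuous_expR R _)).
    - apply/integrableP; split; first exact: measurable_expR_tau.
      by under eq_integral do rewrite gee0_abs ?lee_fin ?expR_ge0//.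
    - apply: aeW => x k _; rewrite gee0_abs ?lee_fin ?expR_ge0// ler_expR.
      by rewrite ler_wpM2l// rtau_ge0.
  move=> /cvge_lt/(_ iu); apply: filterS => k hk; split; last exact: ltW.
  by split=> //; exists C.
have iuf := bounded_integrable nu mfu uC.
have [_ _ cvnu] : [/\ nu.-integrable setT (EFin \o u),
    (\int[nu]_x `|(g k x)%:E - (u x)%:E| @[k --> \oo] --> 0)%E &
    (\int[nu]_x (g k x)%:E @[k --> \oo] --> \int[nu]_x (u x)%:E)%E].
  apply: (@dominated_convergence _ _ _ nu _ measurableT
      (fun k x => (g k x)%:E) _ (fun x => C%:E)).
  - by move=> k; exact/measurable_EFinP.
  - exact/measurable_EFinP.
  - apply: (ae_imp (null_dominates_ae mnu gu)) => x gx _.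
    by apply: cvg_EFin => //; exact: nearW.
  - by apply: finite_measure_integrable_cst.
  - by apply: aeW => x k _; rewrite /= lee_fin.
rewrite -lee_fin fineK; last exact: integrable_fin_num.
apply: cvge_le cvnu; apply: filterS tg => k tgk.
have := nuM tgk; rewrite -lee_fin /Rintegral fineK//.
exact: integrable_fin_num (bounded_integrable nu (mg k) (gC k)).
Qed.

(** Changing a function on the [mu]-null set [N] does not change its exponential moment. The test
    function can thus follow [phi] on the absolutely continuous part and grow to [xi] on the
    singular part at once. *)
Lemma ac_singular_bound (phi : borel X -> R) (C : R) : measurable_fun setT phi ->
  (forall x, `|phi x| <= C) -> (\int[mu]_x (expR (t x * phi x))%:E < 1)%E ->
  (\int[na]_x (Num.max (phi x) 0)%:E + \int[ns]_x xi mu tau x <=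
   M%:E + \int[na]_x (Num.max (- phi x) 0)%:E)%E.
Proof.
move=> mphi phiC iphi.
have [nadom [N [mN muN nsN]] _] := lebesgue_decompositionP nu mu.
have naN : na N = 0%E by move/null_content_dominatesP : nadom => /(_ _ mN muN).
have [w [ew ndw wxi]] := xi_envelope mu mtau tau_ge0.
have mw n : measurable_fun setT (w n) by case: (ew n).
have w0 n x : 0 <= w n x by case: (ew n).
have mwp n : measurable_fun setT (fun x => Num.min (Num.max (phi x) 0) (w n x)).
  by apply: measurable_minr => //; exact: measurable_maxr.
have aeN : {ae na, forall x, ~ N x}.
  by exists N; split => // x /=; rewrite not_notP.
have aesN : {ae ns, forall x, N x}.
  by exists (~` N); split => //; exact: measurableC.
have amu : {ae mu, forall x, ~ N x}.
  by exists N; split => // x /=; rewrite not_notP.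
have mphin : measurable_fun setT (fun x => Num.max (- phi x) 0).
  by apply: measurable_maxr => //; exact: measurableT_comp.
have bound n : (\int[na]_x (Num.min (Num.max (phi x) 0) (w n x))%:E +
    \int[ns]_x (w n x)%:E <= M%:E + \int[na]_x (Num.max (- phi x) 0)%:E)%E.
  (* [mu] and [ac_part nu mu] ignore [N], [singular_part nu mu] lives on it. *)
  pose u x := if x \in N then w n x else Num.min (phi x) (w n x).
  have mu_ : measurable_fun setT u.
    apply: measurable_fun_ifT => //; last exact: measurable_minr.
    apply: (measurable_fun_bool true); rewrite setTI (_ : _ @^-1` _ = N)//.
    by apply/seteqP; split => x /= => [/set_mem|/mem_set].
  have [D wD] : exists D, forall x, w n x <= D by case: (ew n).
  have uD x : `|u x| <= Num.max C D.
    have := phiC x; have := w0 n x; have := wD x; rewrite ler_norml.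
    move=> wx1 wx0 /andP[p1 p2]; rewrite ler_norml lerNl.
    rewrite /u; case: ifPn => _.
      by rewrite !le_max wx1 orbT andbT; apply/orP; right; lra.
    rewrite le_max ge_min !le_max p2 andbT /Num.min.
    by case: ltP => _; apply/orP; [left|right]; lra.
  have uw x : u x <= w n x by rewrite /u; case: ifPn => // _; rewrite ge_min lexx orbT.
  have iu : (\int[mu]_x (expR (t x * u x))%:E < 1)%E.
    apply: le_lt_trans iphi; apply: ae_ge0_le_integral => //.
    - exact: measurable_expR_tau.
    - exact: measurable_expR_tau.
    apply: (ae_imp amu) => x nNx _; rewrite lee_fin ler_expR ler_wpM2l ?rtau_ge0//.
    by rewrite /u memNset// ge_min lexx.
  have := envelope_bound mu_ uD (ew n) uw iu.
  have [a [b [aE bE ->]]] := Rintegral_pos_neg nu mu_ uD.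
  rewrite lerBlDr -lee_fin EFinD -aE -bE.
  have dec (g : borel X -> R) : measurable_fun setT g -> (forall x, 0 <= g x) ->
      (\int[nu]_x (g x)%:E = \int[na]_x (g x)%:E + \int[ns]_x (g x)%:E)%E.
    move=> mg g0; apply: integral_lebesgue_decomposition => //.
    exact/measurable_EFinP.
  have mup : measurable_fun setT (fun x => Num.max (u x) 0) by exact: measurable_maxr.
  have mun : measurable_fun setT (fun x => Num.max (- u x) 0).
    by apply: measurable_maxr => //; exact: measurableT_comp.
  rewrite (dec _ mup)// (dec _ mun)//.
  have -> : (\int[na]_x (Num.max (u x) 0)%:E =
      \int[na]_x (Num.min (Num.max (phi x) 0) (w n x))%:E)%E.
    apply: ge0_ae_eq_integral => //.
    - exact/measurable_EFinP.
    - exact/measurable_EFinP.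
    - by move=> x _; rewrite lee_fin.
    - by move=> x _; rewrite lee_fin le_min pp0 w0.
    apply: (ae_imp aeN) => x nNx _; rewrite /u memNset// maxC max_minr.
    by rewrite (maxC 0) (max_r (w0 n x)).
  have -> : (\int[ns]_x (Num.max (u x) 0)%:E = \int[ns]_x (w n x)%:E)%E.
    apply: ge0_ae_eq_integral => //.
    - exact/measurable_EFinP.
    - exact/measurable_EFinP.
    - by move=> x _; rewrite lee_fin.
    - by move=> x _; rewrite lee_fin.
    apply: (ae_imp aesN) => x Nx _; rewrite /u mem_set//.
    by rewrite max_l.
  have -> : (\int[na]_x (Num.max (- u x) 0)%:E = \int[na]_x (Num.max (- phi x) 0)%:E)%E.
    apply: ge0_ae_eq_integral => //.
    - exact/measurable_EFinP.
    - exact/measurable_EFinP.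
    - by move=> x _; rewrite lee_fin.
    - by move=> x _; rewrite lee_fin.
    apply: (ae_imp aeN) => x nNx _; rewrite /u memNset//; have := w0 n x.
    by case: (leP (phi x) (w n x)) => // h1 h2; rewrite !max_r//; lra.
  have -> : (\int[ns]_x (Num.max (- u x) 0)%:E = 0)%E.
    rewrite -[RHS](integral0 ns setT); apply: ge0_ae_eq_integral => //.
    - exact/measurable_EFinP.
    - by move=> x _; rewrite lee_fin.
    apply: (ae_imp aesN) => x Nx _; rewrite /u mem_set//.
    by rewrite max_r// oppr_le0.
  by rewrite adde0.
(* As [xi] is infinite [mu]-almost everywhere, the cut at [w n] disappears in the limit on the
   absolutely continuous part. *)
have wxi_ae : {ae na, forall x, (w n x)%:E @[n --> \oo] --> +oo%E}.
  apply: (null_dominates_ae nadom).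
  exists [set x | (xi mu tau x < +oo)%E]; split => //.
    rewrite -[mkset _]setTI; apply: emeasurable_fun_infty_o => //.
    exact: measurable_xi.
  move=> x; apply: contra_notP => /=; move/negP; rewrite -leNgt leye_eq => /eqP <-.
  exact: wxi.
have cna : (\int[na]_x (Num.min (Num.max (phi x) 0) (w n x))%:E @[n --> \oo] -->
    \int[na]_x (Num.max (phi x) 0)%:E)%E.
  apply: ae_monotone_cvg.
  - by move=> n; exact/measurable_EFinP.
  - by move=> n x; rewrite lee_fin le_min pp0 w0.
  - move=> x m n mn; rewrite lee_fin le_min ge_min lexx/= ge_min.
    by rewrite (ndw x _ _ mn) orbT.
  - by apply/measurable_EFinP; exact: measurable_maxr.
  - by move=> x; rewrite lee_fin.
  apply: (ae_imp wxi_ae) => x /cvgeyPge/(_ (Num.max (phi x) 0)) h.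
  apply: cvg_near_cst; apply: filterS h => n; rewrite lee_fin => h.
  by rewrite min_l.
have cns : (\int[ns]_x (w n x)%:E @[n --> \oo] --> \int[ns]_x xi mu tau x)%E.
  apply: ae_monotone_cvg.
  - by move=> n; exact/measurable_EFinP.
  - by move=> n x; rewrite lee_fin.
  - by move=> x m n mn; rewrite lee_fin ndw.
  - exact: measurable_xi.
  - by move=> x; exact: xi_ge0.
  by apply: aeW => x; exact: wxi.
apply: (cvge_le _ (cvgeD _ cna cns)); first exact: nearW.
apply: ge0_adde_def; rewrite inE; apply: integral_ge0 => x _.
  by rewrite lee_fin.
exact: xi_ge0.
Qed.

(** The bound [ac_singular_bound] is applied to phi = v / t. Since 1/t may be unbounded, the
    quotient is clamped to [-n, n]; then |t phi| <= |v| <= C, and the constant e^C dominates the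
    exponentials. *)
Lemma tilt_bound (v : borel X -> R) (C : R) : measurable_fun setT v ->
  (forall x, `|v x| <= C) -> (\int[mu]_x (expR (v x))%:E < 1)%E ->
  (\int[kappa]_x (Num.max (v x) 0)%:E + \int[ns]_x xi mu tau x <=
   M%:E + \int[kappa]_x (Num.max (- v x) 0)%:E)%E.
Proof.
move=> mv vC iv.
have mtV : measurable_fun (setT : set (borel X)) (fun x => (t x)^-1) by exact: measurable_rtauV.
have tV0 x : 0 <= (t x)^-1 by rewrite invr_ge0 rtau_ge0.
pose y x := (t x)^-1 * v x.
have my : measurable_fun setT y by exact: measurable_funM.
pose phi (n : nat) x := Num.max (- n%:R) (Num.min n%:R (y x)).
have mphi n : measurable_fun setT (phi n).
  by apply: measurable_maxr => //; exact: measurable_minr.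
have phin n x : `|phi n x| <= n%:R by exact: norm_clamp.
have typhi n x : `|t x * phi n x| <= `|v x|.
  rewrite normrM (ger0_norm (rtau_ge0 tau_ge0 x)).
  apply: (@le_trans _ _ (t x * `|y x|)).
    by rewrite ler_wpM2l ?rtau_ge0// norm_clamp_le.
  rewrite /y normrM (ger0_norm (tV0 x)) mulrA.
  have [->|t0] := eqVneq (t x) 0; first by rewrite mul0r mul0r.
  by rewrite divff// mul1r.
have [_ _ ecvg] : [/\ mu.-integrable setT (fun x => (expR (v x))%:E),
    (\int[mu]_x `|(expR (t x * phi n x))%:E - (expR (v x))%:E| @[n --> \oo] --> 0)%E &
    (\int[mu]_x (expR (t x * phi n x))%:E @[n --> \oo] --> \int[mu]_x (expR (v x))%:E)%E].
  apply: (@dominated_convergence _ _ _ mu _ measurableT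
    (fun n x => (expR (t x * phi n x))%:E) _ (fun x => (expR C)%:E)).
  - by move=> n; exact: measurable_expR_tau.
  - by apply/measurable_EFinP; exact: measurableT_comp.
  - apply: (ae_imp (ae_rtau mtau tau_ge0 tau_neq0 tau_neqy)) => x [_ t0] _.
    apply: cvg_near_cst; near=> n; rewrite /phi clampK.
      by rewrite /y mulrA divff ?mul1r// gt_eqF.
    by near: n; exact: nbhs_infty_ger.
  - by apply: finite_measure_integrable_cst.
  - apply: aeW => x n _; rewrite gee0_abs ?lee_fin ?expR_ge0// ler_expR.
    by rewrite (le_trans (ler_norm _))// (le_trans (typhi _ _))// vC.
have kE (g : R -> R) : measurable_fun setT g -> (forall r, 0 <= g r) ->
    (\int[kappa]_x (g (v x))%:E = \int[na]_x ((t x)^-1 * g (v x))%:E)%E.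
  move=> mg g0; rewrite integral_tilt//.
  - by apply: eq_integral => x _; rewrite -EFinM mulrC.
  - by apply/measurable_EFinP; exact: measurableT_comp.
  - by move=> x; rewrite lee_fin.
have mpos : measurable_fun setT (fun r : R => Num.max r 0) by exact: measurable_maxr.
have mneg : measurable_fun setT (fun r : R => Num.max (- r) 0).
  by apply: measurable_maxr => //; exact: measurableT_comp.
rewrite (kE (fun r => Num.max r 0))// (kE (fun r => Num.max (- r) 0))//.
have posE x : (t x)^-1 * Num.max (v x) 0 = Num.max (y x) 0.
  by rewrite maxr_pMr// mulr0.
have negE x : (t x)^-1 * Num.max (- v x) 0 = Num.max (- y x) 0.
  by rewrite maxr_pMr// mulr0 mulrN.
have mposy : measurable_fun setT (fun x => Num.max (y x) 0) by exact: measurable_maxr.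
have mnegy : measurable_fun setT (fun x => Num.max (- y x) 0).
  by apply: measurable_maxr => //; exact: measurableT_comp.
under [X in (X + _ <= _)%E]eq_integral do rewrite posE.
under [X in (_ <= _ + X)%E]eq_integral do rewrite negE.
have cna : (\int[na]_x (Num.min n%:R (Num.max (y x) 0))%:E @[n --> \oo] -->
    \int[na]_x (Num.max (y x) 0)%:E)%E.
  apply: ae_monotone_cvg.
  - by move=> n; apply/measurable_EFinP; exact: measurable_minr.
  - by move=> n x; rewrite lee_fin le_min pp0 ler0n.
  - move=> x m n mn; rewrite lee_fin le_min !ge_min lexx orbT andbT.
    by rewrite ler_nat mn.
  - exact/measurable_EFinP.
  - by move=> x; rewrite lee_fin.
  apply: aeW => x; apply: cvg_near_cst; near=> n; rewrite min_r//.
  by near: n; exact: nbhs_infty_ger.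
apply: (cvge_le _ (cvgeD _ cna (cvg_cst _))); last first.
  by apply: ge0_adde_def; rewrite inE; apply: integral_ge0 => x _;
    [rewrite lee_fin|exact: xi_ge0].
apply: filterS (cvge_lt _ ecvg iv) => n ien.
have := ac_singular_bound (mphi n) (phin n) ien.
under [X in (X + _ <= _)%E -> _]eq_integral do rewrite pos_clamp//.
under [X in (_ <= _ + X)%E -> _]eq_integral do rewrite neg_clamp//.
move=> /le_trans; apply; rewrite leeD2l//; apply: ge0_le_integral => //.
- by move=> x _; rewrite lee_fin le_min pp0 ler0n.
- by apply/measurable_EFinP; exact: measurable_minr.
- exact/measurable_EFinP.
- by move=> x _; rewrite lee_fin ge_min lexx orbT.
Unshelve. all: by end_near. Qed.

Let expRN1 : expR (-1) <= 2^-1 :> R.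
Proof.
rewrite expRN lef_pV2 ?posrE ?expR_gt0//.
by have := @expR_ge1Dx R 1; lra.
Qed.

Lemma tilt_finite : (kappa setT < +oo)%E.
Proof.
pose B (n : nat) : set (borel X) := [set x | t x < n.+1%:R^-1].
have mB n : measurable (B n).
  rewrite (_ : B n = setT `&` t @^-1` `]-oo, n.+1%:R^-1[); first exact: mt.
  by rewrite setTI; apply/seteqP; split => x; rewrite /B /= in_itv.
(* With [v] equal to 1 on [B n] and -1 elsewhere, the moment is at most e^(-1) + e mu(B n) <= 1/2 +
   1/4. *)
have e0 : 0 < expR (-1) / 4 :> R by rewrite divr_gt0// expR_gt0.
have [|| n mBn] := @measure_vanishing_seq _ _ _ mu B _ mB _ _ e0.
- move=> m k mk; apply/subsetPset => x; rewrite /B /= => /lt_le_trans; apply.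
  by rewrite lef_pV2 ?posrE// ler_nat.
- have [N [mN muN tN]] := ae_rtau mtau tau_ge0 tau_neq0 tau_neqy.
  apply/(negligibleP _ (bigcap_measurable _ _)); last first.
    exists N; split => // x xB; apply: tN => /= -[_ t0].
    have := xB (Num.truncn (t x)^-1) I; rewrite /B/=; apply/negP; rewrite -leNgt.
    by rewrite -[leRHS]invrK lef_pV2 ?posrE ?invr_gt0//; exact/ltW/truncnS_gt.
  by [].
  by [].
have mC : measurable (~` B n) by exact: measurableC.
(* Off [B n] the tilt has mass at most [n.+1], and [mu (B n)] is small enough
   for [v] to be admissible. *)
pose v x : R := \1_(B n) x - \1_(~` B n) x.
have mv : measurable_fun setT v by apply: measurable_funB; exact: measurable_indic.
have vE x : v x = if x \in B n then 1 else - 1.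
  by rewrite /v !indicE in_setC; case: (x \in B n) => /=; lra.
have v1 x : `|v x| <= 1 by rewrite vE; case: ifPn => _; rewrite ?normrN normr1.
have iv : (\int[mu]_x (expR (v x))%:E < 1)%E.
  apply: (@le_lt_trans _ _ (\int[mu]_x ((expR (-1))%:E + (expR 1)%:E * (\1_(B n) x)%:E))%E).
    apply: ge0_le_integral => //.
    - by apply/measurable_EFinP; exact: measurableT_comp.
    - apply: emeasurable_funD => //; apply: emeasurable_funM => //.
      by apply/measurable_EFinP; exact: measurable_indic.
    move=> x _; rewrite -EFinM -EFinD lee_fin vE indicE.
    by case: ifPn => _ /=; rewrite ?mulr1 ?mulr0 ?addr0// lerDr expR_ge0.
  rewrite ge0_integralD//; first last.
  - apply: emeasurable_funM => //.
    by apply/measurable_EFinP; exact: measurable_indic.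
  rewrite integral_cst// ge0_integralZl//; first last.
  - by apply/measurable_EFinP; exact: measurable_indic.
  rewrite integral_indic// setIT.
  apply: (@le_lt_trans _ _ ((expR (-1))%:E * 1 + (expR 1)%:E * (expR (-1) / 4)%:E)%E).
    apply: leeD; apply: lee_wpmul2l => //; rewrite ?lee_fin ?expR_ge0//.
    exact: probability_le1.
  rewrite mule1 -EFinM -EFinD lte_fin mulrA -expRD subrr expR0.
  by have := expRN1; lra.
have := tilt_bound mv v1 iv.
have mvp : measurable_fun setT (fun x => (Num.max (v x) 0)%:E).
  by apply/measurable_EFinP; exact: measurable_maxr.
have mvn : measurable_fun setT (fun x => (Num.max (- v x) 0)%:E).
  by apply/measurable_EFinP; apply: measurable_maxr => //; exact: measurableT_comp.
have nfin : (\int[kappa]_x (Num.max (- v x) 0)%:E < +oo)%E.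
  rewrite integral_tilt//; last by move=> x; rewrite lee_fin.
  have naT : (na setT <= 1)%E.
    have [_ _ h] := lebesgue_decompositionP nu mu.
    have <- := probability_setT nu; rewrite (h _ measurableT) leeDl//.
  apply: (@le_lt_trans _ _ (\int[na]_x (n.+1%:R)%:E)%E).
    apply: ge0_le_integral => //.
    - by move=> x _; rewrite -EFinM lee_fin mulr_ge0// invr_ge0 rtau_ge0.
    - by apply: emeasurable_funM => //; apply/measurable_EFinP; exact: measurable_rtauV.
    move=> x _; rewrite -EFinM lee_fin vE; case: ifPn => xB.
      by rewrite max_r ?mul0r// lerN10.
    rewrite opprK max_l// mul1r -[leRHS]invrK.
    have : n.+1%:R^-1 <= t x.
      by rewrite leNgt; apply/negP => h; move: xB; rewrite mem_set.
    move=> h; rewrite lef_pV2 ?posrE ?invr_gt0//.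
    by apply: lt_le_trans h; rewrite invr_gt0.
  by rewrite integral_cst// (le_lt_trans (lee_wpmul2l _ naT))// mule1 ltry.
have -> : kappa setT =
    (\int[kappa]_x (Num.max (v x) 0)%:E + \int[kappa]_x (Num.max (- v x) 0)%:E)%E.
  rewrite -ge0_integralD//; [|by move=> x _; rewrite lee_fin..].
  rewrite -[LHS]mul1e -integral_cst//; apply: eq_integral => x _ /=.
  rewrite -EFinD vE; case: ifPn => _.
    by rewrite max_l// max_r ?lerN10// addr0.
  by rewrite opprK max_r ?lerN10// max_l// add0r.
move=> h; rewrite lte_add_pinfty//.
apply: (@le_lt_trans _ _ (M%:E + \int[kappa]_x (Num.max (- v x) 0)%:E)%E); last first.
  by rewrite lte_add_pinfty// ltry.
by apply: le_trans h; rewrite leeDl//; apply: integral_ge0 => x _; exact: xi_ge0.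
Qed.

(** The test function is the constant -1, whose moment e^(-1) is below 1. The bound makes the
    singular term finite, hence subtractable, and it is the whole claim when the tilt has mass 0. *)
Lemma singular_le_tilt : (\int[ns]_x xi mu tau x <= M%:E + kappa setT)%E.
Proof.
have := @tilt_bound (fun=> -1) 1.
have mc : measurable_fun (setT : set (borel X)) (fun=> -1 : R) by [].
move=> /(_ mc); rewrite normrN normr1 => /(_ (fun=> lexx _)).
rewrite max_r ?lerN10// opprK max_l// integral0 add0e.
rewrite !integral_cst// mul1e; apply.
rewrite -[ltRHS]mule1; apply: (@le_lt_trans _ _ ((expR (-1))%:E * 1)%E).
  by apply: lee_wpmul2l; [rewrite lee_fin expR_ge0|exact: probability_le1].
by rewrite !mule1 lte_fin; have := expRN1; lra.
Qed.

(** In Young's inequality the optimal u is ln rho, here with rho truncated to [[1/(k+1), k+1]] so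
    that [v k] is bounded. The integrals of [h k] are bounded uniformly in [k], and Fatou's lemma
    passes to the limit. *)
Lemma entropy_approx (z s : R) : 0 < z -> kappa setT = z%:E ->
  (\int[ns]_x xi mu tau x = s%:E)%E ->
  (relative_entropy (ac_tilt mu mtau tau_ge0 nu) mu <= ((M - s) / z)%:E)%E.
Proof.
move=> z0 zE sE; set P := ac_tilt mu mtau tau_ge0 nu.
have [rho [mrho rho0 rhoE ->]] := relative_entropy_density (ac_tilt_dominated z0 zE).
have P_bound (v : borel X -> R) (C : R) : measurable_fun setT v ->
    (forall x, `|v x| <= C) -> (\int[mu]_x (expR (v x))%:E < 1)%E ->
    Rintegral P setT v <= (M - s) / z.
  move=> mv vC iv; have := tilt_bound mv vC iv.
  have [a [b [aE bE ->]]] := Rintegral_pos_neg P mv vC.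
  have mvp : measurable_fun setT (fun x => (Num.max (v x) 0)%:E).
    by apply/measurable_EFinP; exact: measurable_maxr.
  have mvn : measurable_fun setT (fun x => (Num.max (- v x) 0)%:E).
    by apply/measurable_EFinP; apply: measurable_maxr => //; exact: measurableT_comp.
  rewrite -!(integral_ac_tilt z0 zE)//; [|by move=> x; rewrite lee_fin..].
  rewrite aE bE sE -!EFinM -!EFinD lee_fin ler_pdivlMr// => h.
  by lra.
pose c (k : nat) x := Num.max k.+1%:R^-1 (Num.min k.+1%:R (rho x)).
pose v k x := ln (c k x).
have k1 (k : nat) : k.+1%:R^-1 <= 1 :> R by rewrite invf_le1// ler1n.
have k2 (k : nat) : 1 <= k.+1%:R :> R by rewrite ler1n.
have k0 (k : nat) : 0 < k.+1%:R^-1 :> R by rewrite invr_gt0.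
have c_ge k x : k.+1%:R^-1 <= c k x by rewrite le_max lexx.
have c_le k x : c k x <= k.+1%:R.
  by rewrite ge_max ge_min lexx/= andbT (le_trans (k1 _)).
have c_gt0 k x : 0 < c k x by exact: lt_le_trans (c_ge k x).
have mc k : measurable_fun setT (c k).
  by apply: measurable_maxr => //; exact: measurable_minr.
have mv k : measurable_fun setT (v k) by apply: measurableT_comp (mc k); exact: measurable_ln.
have vC k x : `|v k x| <= ln k.+1%:R.
  rewrite ler_norml; apply/andP; split.
    by rewrite -lnV ?posrE// ler_ln ?posrE.
  by rewrite ler_ln ?posrE.
have ev k x : expR (v k x) = c k x by rewrite lnK// posrE.
pose h k x := rho x * v k x - c k x + 1.
(* With c = [c k x], h = (rho - c) ln c + entropy_fun c. Truncation moves rho towards 1, so rho - c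
   and ln c never have opposite strict signs. *)
have h0 k x : 0 <= h k x.
  have : 0 <= (rho x - c k x) * v k x.
    rewrite /v /c; case: (leP k.+1%:R (rho x)) => r1.
      rewrite (max_r (le_trans (k1 k) (k2 k))) mulr_ge0 ?subr_ge0//.
      exact: ln_ge0.
    case: (leP k.+1%:R^-1 (rho x)) => r2; first by rewrite subrr mul0r.
    by rewrite mulr_le0// ?subr_le0 ?(ltW r2)// ln_le0.
  have := entropy_fun_ge0 (c k x); rewrite /entropy_fun /h -/(v k x).
  by rewrite mulrBl mulrBr mulr1; lra.
have mh k : measurable_fun setT (h k).
  by apply: measurable_funD => //; apply: measurable_funB => //; exact: measurable_funM.
have int_h k : (\int[mu]_x (h k x)%:E <= ((M - s) / z)%:E)%E.
  have [a [b [aE bE abE]]] := Rintegral_pos_neg P (mv k) (vC k).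
  have cC x : `|c k x| <= k.+1%:R by rewrite ger0_norm// ltW.
  have ic := bounded_integrable mu (mc k) cC.
  pose e := Rintegral mu setT (c k).
  have eE : (\int[mu]_x (c k x)%:E = e%:E)%E.
    by rewrite /e /Rintegral fineK//; exact: integrable_fin_num ic.
  have mvp : measurable_fun setT (fun x => (Num.max (v k x) 0)%:E).
    by apply/measurable_EFinP; exact: measurable_maxr.
  have mvn : measurable_fun setT (fun x => (Num.max (- v k x) 0)%:E).
    by apply/measurable_EFinP; apply: measurable_maxr => //; exact: measurableT_comp.
  have vp0 x : (0 <= (Num.max (v k x) 0)%:E)%E by rewrite lee_fin.
  have vn0 x : (0 <= (Num.max (- v k x) 0)%:E)%E by rewrite lee_fin.
  have mr : measurable_fun setT (EFin \o rho) by exact/measurable_EFinP.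
  have mhe : measurable_fun setT (fun x => (h k x)%:E) by exact/measurable_EFinP.
  have mce : measurable_fun setT (fun x => (c k x)%:E) by exact/measurable_EFinP.
  have r0 x : (0 <= (rho x)%:E)%E by rewrite lee_fin.
  have he0 x : (0 <= (h k x)%:E)%E by rewrite lee_fin.
  have ce0 x : (0 <= (c k x)%:E)%E by rewrite lee_fin ltW.
  (* With the negative part of [v k] on the left all terms are nonnegative, and the pointwise
     identity h + rho v^- + c = rho v^+ + 1 integrates term by term. *)
  have hE : (\int[mu]_x (h k x)%:E + b%:E + e%:E = a%:E + 1)%E.
    rewrite -aE -bE -eE !rhoE//.
    have i1 : (\int[mu]_x (cst 1%E x) = 1)%E.
      by rewrite integral_cst// mul1e; exact: probability_setT.
    rewrite -[X in (_ = _ + X)%E]i1.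
    have mn : measurable_fun setT (fun x => (Num.max (- v k x) 0)%:E * (rho x)%:E)%E.
      exact: emeasurable_funM.
    have mp : measurable_fun setT (fun x => (Num.max (v k x) 0)%:E * (rho x)%:E)%E.
      exact: emeasurable_funM.
    have n0 x : (0 <= (Num.max (- v k x) 0)%:E * (rho x)%:E)%E by rewrite mule_ge0.
    have p0 x : (0 <= (Num.max (v k x) 0)%:E * (rho x)%:E)%E by rewrite mule_ge0.
    have hn0 x : (0 <= (h k x)%:E + (Num.max (- v k x) 0)%:E * (rho x)%:E)%E.
      by rewrite adde_ge0.
    have mhn : measurable_fun setT
        (fun x => (h k x)%:E + (Num.max (- v k x) 0)%:E * (rho x)%:E)%E.
      exact: emeasurable_funD.
    rewrite -ge0_integralD// -ge0_integralD// -ge0_integralD//.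
    apply: eq_integral => x _; rewrite /= -!EFinM -!EFinD; congr (_%:E).
    rewrite /h; case: (leP 0 (v k x)) => v0.
      by rewrite max_r ?oppr_le0// mul0r; ring.
    by rewrite max_l ?oppr_ge0 ?(ltW v0)// mul0r; ring.
  have hfin : (\int[mu]_x (h k x)%:E)%E \is a fin_num.
    rewrite ge0_fin_numE; last by apply: integral_ge0 => x _.
    apply: (@le_lt_trans _ _ (a%:E + 1)%E); last by rewrite -EFinD ltry.
    rewrite -hE -addeA leeDl// adde_ge0//.
      by rewrite -bE; apply: integral_ge0 => x _.
    by rewrite -eE; apply: integral_ge0 => x _.
  move: hE; rewrite -(fineK hfin) -!EFinD => -[hE].
  (* [1 + l <= expR l] makes [v k - l] admissible. *)
  apply/ler_addgt0Pr => d d0; pose l := e - 1 + d.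
  have il : (\int[mu]_x (expR (v k x - l))%:E < 1)%E.
    under eq_integral do rewrite expRB ev mulrC EFinM.
    rewrite ge0_integralZl//.
    rewrite eE -EFinM lte_fin mulrC ltr_pdivrMr ?expR_gt0// mul1r.
    by apply: lt_le_trans (@expR_ge1Dx _ l); rewrite /l; lra.
  have ml : measurable_fun setT (fun x => v k x - l) by exact: measurable_funB.
  have vlC x : `|v k x - l| <= ln k.+1%:R + `|l|.
    by rewrite (le_trans (ler_normB _ _))// lerD2r vC.
  have := P_bound _ _ ml vlC il.
  have il1 : P.-integrable setT (EFin \o (fun=> l)).
    by apply: finite_measure_integrable_cst.
  rewrite RintegralB//; last exact: bounded_integrable (mv k) (vC k).
  rewrite (Rintegral_cst _ measurableT) (congr1 fine (probability_setT P)) mulr1 abE.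
  by rewrite /l; lra.
have lim_h x : (h k x)%:E @[k --> \oo] --> (entropy_fun (rho x))%:E.
  suff hc : h k x @[k --> \oo] --> entropy_fun (rho x).
    by apply: cvg_EFin hc; exact: nearW.
  (* Where rho vanishes the truncation never becomes exact; there h = 1 - 1/(k+1), which tends to
     h(0) = 1. *)
  have [r0|r0] := eqVneq (rho x) 0.
    have -> : (fun k => h k x) = (fun k => - k.+1%:R^-1 + 1).
      by apply/funext => k; rewrite /h r0 mul0r sub0r /c r0 min_r ?ler0n// max_l// ltW.
    rewrite r0 /entropy_fun mul0r add0r -[X in _ --> X]add0r -oppr0.
    by apply: cvgD; [apply: cvgN; exact: cvg_harmonic|exact: cvg_cst].
  have rgt0 : 0 < rho x by rewrite lt_neqAle eq_sym r0 rho0.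
  apply: cvg_near_cst; near=> k.
  have ck : c k x = rho x.
    have a1 : rho x <= k.+1%:R.
      apply: (@le_trans _ _ k%:R); last by rewrite ler_nat.
      by near: k; exact: nbhs_infty_ger.
    have a2 : k.+1%:R^-1 <= rho x.
      rewrite -[leRHS]invrK lef_pV2 ?posrE ?invr_gt0//.
      apply: (@le_trans _ _ k%:R); last by rewrite ler_nat.
      by near: k; exact: nbhs_infty_ger.
    by rewrite /c min_r// max_r.
  by rewrite /h /v ck /entropy_fun; ring.
rewrite (_ : (\int[mu]_x _ = \int[mu]_x limn_einf (fun k => (h k x)%:E))%E); last first.
  apply: eq_integral => x _; by have [-> _] := cvg_limn_einf_sup (lim_h x).
apply: le_trans (fatou _ _ _ _) _ => //.
- by move=> k; exact/measurable_EFinP.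
- by move=> k x _; rewrite lee_fin.
rewrite limn_einf_lim; apply: lime_le; first exact: is_cvg_einfs.
apply: nearW => k; apply: le_trans (int_h k).
by apply: ereal_inf_lbound; exists k => /=.
Unshelve. all: by end_near. Qed.

Lemma rate_functional_le : (rate_functional mu mtau tau_ge0 nu <= M%:E)%E.
Proof.
have kfin := tilt_finite; rewrite /rate_functional.
set Z := (\int[na]_x _)%E; have ZE : Z = kappa setT by [].
rewrite ZE kfin; have SM := singular_le_tilt.
have S0 : (0 <= \int[ns]_x xi mu tau x)%E by apply: integral_ge0 => x _; exact: xi_ge0.
have [k0|k0] := eqVneq (kappa setT) 0%E.
  by rewrite add0e; move: SM; rewrite k0 adde0.
have kf : kappa setT \is a fin_num by rewrite ge0_fin_numE.
have z0 : 0 < fine (kappa setT) by rewrite fine_gt0// kfin lt0e k0 measure_ge0.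
have zE : kappa setT = (fine (kappa setT))%:E by rewrite fineK.
have Sfin : (\int[ns]_x xi mu tau x)%E \is a fin_num.
  rewrite ge0_fin_numE// (le_lt_trans SM)// zE -EFinD ltry//.
set S := (\int[ns]_x xi mu tau x)%E in S0 SM Sfin *.
have sE : S = (fine S)%:E by rewrite fineK.
have := entropy_approx z0 zE sE.
rewrite -(@lee_pmul2l _ (fine (kappa setT))%:E)// -zE => h.
apply: (@le_trans _ _ ((fine (kappa setT))%:E * 
    ((M - fine S) / fine (kappa setT))%:E + S)%E).
  by rewrite leeD2r// -zE.
by rewrite sE -EFinM -EFinD lee_fin/= mulrC divfK ?gt_eqF// subrK.
Qed.

End rate_lower.

(** * Convexity and goodness *)

Lemma Rintegral_mixture d (T : measurableType d) (R : realType) (s : {i01 R})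
    (nu1 nu2 : probability T R) (f : T -> R) (C : R) :
  measurable_fun setT f -> (forall x, `|f x| <= C) ->
  Rintegral (mixture s nu1 nu2) setT f =
    s%:num * Rintegral nu1 setT f + (1 - s%:num) * Rintegral nu2 setT f.
Proof.
move=> mf fC; pose P : probability T R := mixture s nu1 nu2.
have s0 : 0 <= s%:num by [].
have s1 : 0 <= 1 - s%:num by rewrite subr_ge0.
have PE (g : T -> \bar R) : measurable_fun setT g -> (forall x, 0 <= g x)%E ->
    (\int[P]_x g x = s%:num%:E * \int[nu1]_x g x + (1 - s%:num)%:E * \int[nu2]_x g x)%E.
  move=> mg g0; rewrite (eq_measure_integral (measure_add (mscale (NngNum s0) nu1)
    (mscale (NngNum s1) nu2))); last first.
    by move=> A mA _; rewrite /= /msum 2!big_ord_recl/= big_ord0 adde0.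
  by rewrite ge0_integral_measure_add// !ge0_integral_mscale.
have mp : measurable_fun setT (fun x => (Num.max (f x) 0)%:E).
  by apply/measurable_EFinP; exact: measurable_maxr.
have mn : measurable_fun setT (fun x => (Num.max (- f x) 0)%:E).
  by apply/measurable_EFinP; apply: measurable_maxr => //; exact: measurableT_comp.
have [a [b [aE bE ->]]] := Rintegral_pos_neg P mf fC.
have [a1 [b1 [a1E b1E ->]]] := Rintegral_pos_neg nu1 mf fC.
have [a2 [b2 [a2E b2E ->]]] := Rintegral_pos_neg nu2 mf fC.
move: aE bE; rewrite !PE//; try by move=> x; rewrite lee_fin le_max lexx orbT.
rewrite a1E a2E b1E b2E -!EFinM -!EFinD => -[<-] [<-].
by ring.
Qed.

Section goodness.
Context {R : realType} {X : polishMetricType R}.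
Variables (mu : probability (borel X) R) (tau : X -> \bar R).
Hypothesis mtau : measurable_fun (setT : set (borel X)) tau.
Hypothesis tau_ge0 : forall x, (0 <= tau x)%E.
Hypothesis tau_neq0 : mu [set x | tau x = 0%E] = 0%E.
Hypothesis tau_neqy : mu [set x | tau x = +oo%E] = 0%E.
Hypothesis xi_eqy : mu [set x | (xi mu tau x < +oo)%E] = 0%E.
Hypothesis xi_infty_eqy : xi_infty mu tau = +oo%E.

Local Notation t := (rtau tau).
Local Notation rate := (rate_functional mu mtau tau_ge0).

Let mt : measurable_fun setT t. Proof. exact: measurable_rtau. Qed.

Let t0 x : 0 <= t x. Proof. exact: rtau_ge0. Qed.

Lemma rate_functional_leP (nu : narrow X) (M : R) : (rate nu <= M%:E)%E <->
  forall f, test_fun mu tau f ->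
    Rintegral (nu : probability (borel X) R) setT f <= M.
Proof.
split=> [IM f tf|h]; last exact: rate_functional_le.
exact: rate_functional_ge tf IM.
Qed.

Lemma rate_functional_ge0 nu : (0 <= rate nu)%E.
Proof.
rewrite /rate_functional; case: ifPn => // _; rewrite adde_ge0//.
  case: ifPn => // _; rewrite mule_ge0 ?relative_entropy_ge0//.
  by apply: integral_ge0 => x _; exact: inv_tau_ge0.
by apply: integral_ge0 => x _; exact: xi_ge0.
Qed.

Lemma convex_rate_functional : convex_functional rate.
Proof.
move=> nu1 nu2 s; set r := (X in (_ <= X)%E).
have s0 : 0 <= s%:num by [].
have s1 : 0 <= 1 - s%:num by rewrite subr_ge0.
have r1 : (0 <= s%:num%:E * rate nu1)%E by rewrite mule_ge0// rate_functional_ge0.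
have r2 : (0 <= (1 - s%:num)%:E * rate nu2)%E by rewrite mule_ge0// rate_functional_ge0.
have [roo|rlt] := leP +oo%E r; first by apply: le_trans roo; rewrite leey.
have f1 : (s%:num%:E * rate nu1)%E \is a fin_num.
  by rewrite ge0_fin_numE// (le_lt_trans _ rlt)// leeDl.
have f2 : ((1 - s%:num)%:E * rate nu2)%E \is a fin_num.
  by rewrite ge0_fin_numE// (le_lt_trans _ rlt)// leeDr.
rewrite /r -(fineK f1) -(fineK f2) -EFinD.
apply/rate_functional_leP => f tf; have [[cf [C fC]] _] := tf.
rewrite (Rintegral_mixture _ _ _ (continuous_borel cf) fC).
(* A zero weight allows an infinite rate, the product being 0 by convention; for a positive weight
   the finite product forces a finite rate. *)
have part (a : R) (nu : probability (borel X) R) : 0 <= a ->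
    (a%:E * rate nu)%E \is a fin_num -> a * Rintegral nu setT f <= fine (a%:E * rate nu)%E.
  rewrite le_eqVlt => /predU1P[<-|a0 afin]; first by rewrite mul0e mul0r.
  have Ifin : rate nu \is a fin_num.
    rewrite ge0_fin_numE ?rate_functional_ge0// ltNge leye_eq; apply/negP => /eqP Ioo.
    by move: afin; rewrite Ioo gt0_muley.
  rewrite fineM// ler_pM2l//; apply: (@rate_functional_ge _ _ mu tau mtau tau_ge0) => //.
  by rewrite fineK.
by apply: lerD; exact: part.
Qed.

Lemma closed_rate_functional (M : R) : closed [set nu | (rate nu <= M%:E)%E].
Proof.
rewrite (_ : mkset _ = \bigcap_(f in [set f : bounded_continuous X | test_fun mu tau (sval f)])
    (narrow_eval f @^-1` [set r | r <= M])).
  apply: closed_bigI => f _; apply: closed_comp; last exact: closed_le.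
  by move=> nu _; exact: narrow_eval_continuous.
apply/seteqP; split => nu /=.
  by move/rate_functional_leP => h f /= tf; exact: h.
move=> h; apply/rate_functional_leP => f tf; have [Cf _] := tf.
exact: (h (exist _ f Cf) tf).
Qed.

(** * Compactness of the sublevel sets *)

(** The open sets where [f n < e] cover [K]; by monotonicity the largest index of a finite subcover
    serves all points. *)
Lemma dini (K : set X) (f : nat -> X -> R) (e : R) : compact K ->
  (forall n, continuous (f n)) -> (forall x, nonincreasing_seq (f^~ x)) ->
  (forall x, f n x @[n --> \oo] --> 0) -> 0 < e ->
  exists n, forall x, K x -> f n x < e.
Proof.
move=> cK cf ndf f0 e0; move: cK; rewrite compact_cover.
move=> /(_ nat setT (fun n => [set x | f n x < e])) [].
- move=> n _; rewrite (_ : mkset _ = f n @^-1` [set r | r < e])//.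
  by move/continuousP: (cf n); apply; exact: open_lt.
- move=> x Kx; have [n _ fn] := cvgr_lt _ (f0 x) _ e0.
  by exists n => //=; exact: (fn n (leqnn n)).
move=> D _ KD; exists (\max_(i <- finmap.enum_fset D) i)%N => x /KD[i /= iD fi].
by apply: le_lt_trans fi; apply: ndf; exact: leq_bigmax_seq.
Qed.

(** As t > 0 almost everywhere, e^(-n t) tends to 0 boundedly. In the test function c phi - b this
    spends half of the moment budget 1 on the region where phi vanishes; [tail_exp_moment] spends
    the other half. *)
Lemma exp_moment_vanishing : exists b : R, 0 < b /\
  (\int[mu]_x (expR (t x * - b))%:E < (2^-1)%:E)%E.
Proof.
have [_ _ h] : [/\ mu.-integrable setT (fun=> 0%E : \bar R),
    (\int[mu]_x `|(expR (t x * - n.+1%:R))%:E - 0| @[n --> \oo] --> 0)%E &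
    (\int[mu]_x (expR (t x * - n.+1%:R))%:E @[n --> \oo] --> \int[mu]_x 0)%E].
  apply: (@dominated_convergence _ _ _ mu _ measurableT
    (fun n x => (expR (t x * - n.+1%:R))%:E) _ (fun=> 1%E)).
  - by move=> n; exact: measurable_expR_tau.
  - by [].
  - apply: (ae_imp (ae_rtau mtau tau_ge0 tau_neq0 tau_neqy)) => x [_ tx] _.
    have hx : (1 + t x * n.+1%:R)^-1 @[n --> \oo] --> (0 : R).
      apply: (@squeeze_cvgr _ _ _ _ (fun=> 0) (fun n => (t x)^-1 * n.+1%:R^-1)).
      - apply: nearW => n; rewrite invr_ge0 addr_ge0 ?mulr_ge0//=.
        rewrite -invfM lef_pV2 ?posrE ?mulr_gt0// ?ltr_wpDl ?mulr_gt0//.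
        by rewrite lerDr.
      - exact: cvg_cst.
      - rewrite -[X in _ --> X](mulr0 (t x)^-1); apply: cvgM; first exact: cvg_cst.
        exact: cvg_harmonic.
    apply: cvg_EFin; first exact: nearW.
    apply: (@squeeze_cvgr _ _ _ _ (fun=> 0) (fun n => (1 + t x * n.+1%:R)^-1)) => //.
    + apply: nearW => n; rewrite /= expR_ge0/= mulrN expRN lef_pV2 ?posrE ?expR_gt0//.
        exact: expR_ge1Dx.
      by rewrite ltr_wpDr// mulr_ge0.
    + exact: cvg_cst.
  - by apply: finite_measure_integrable_cst.
  - apply: aeW => x n _; rewrite gee0_abs ?lee_fin ?expR_ge0//.
    by rewrite expR_le1// mulrN oppr_le0 mulr_ge0.
rewrite integral0 in h.
have h0 : (0 < (2^-1 : R)%:E)%E by rewrite lte_fin.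
have [n _ hn] := cvge_lt _ h h0.
by exists n.+1%:R; split => //; exact: (hn n (leqnn n)).
Qed.

Lemma compact_exp_moment (c : R) : exists K : set X, exists c' : R,
  [/\ compact K, c < c', 0 <= c' &
  (\int[mu]_(x in ~` K) (expR (t x * c'))%:E < +oo)%E].
Proof.
have : (c%:E < xi_infty mu tau)%E by rewrite xi_infty_eqy ltry.
move=> /ereal_sup_gt[_ [K cK <-]] /ereal_sup_gt[_ [c' [c'0 ic] <-]].
rewrite lte_fin => cc'; exists K, c'; split => //.
have mK : measurable (~` K : set (borel X)).
  apply: open_borel; apply: closed_openC; apply: compact_closed => //.
  exact: metric_hausdorff.
apply: le_lt_trans ic; apply: ge0_le_integral => //.
- by apply: measurable_funTS; exact: measurable_expR_tau.
- by apply: measurable_funTS; exact: measurable_expeR_tau.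
- by move=> x _; exact: expR_le_expeR.
Qed.

(** By Dini the sets where [f n > e] eventually avoid a compact [K] off which e^(c' t) is
    integrable. They shrink to the empty set, so dominated convergence makes their moment small for
    a fixed [c']. *)
Lemma tail_exp_moment (f : nat -> X -> R) (e c : R) : (forall n, continuous (f n)) ->
  (forall x, nonincreasing_seq (f^~ x)) -> (forall x, f n x @[n --> \oo] --> 0) ->
  0 < e -> exists c' : R, [/\ c < c', 0 <= c' & exists n,
    (\int[mu]_(x in [set x | (e < f n x)%R]) (expR (t x * c'))%:E < (2^-1)%:E)%E].
Proof.
move=> cf ndf f0 e0; have [K [c' [cK cc' c'0 ic]]] := compact_exp_moment c.
exists c'; split => //; have [m fm] := dini cK cf ndf f0 e0.
pose V n : set (borel X) := [set x | e < f n x].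
have mV n : measurable (V n).
  apply: open_borel; rewrite (_ : V n = f n @^-1` [set r | e < r])//.
  by move/continuousP: (cf n); apply; exact: open_gt.
have mK : measurable (~` K : set (borel X)).
  apply: open_borel; apply: closed_openC; apply: compact_closed => //.
  exact: metric_hausdorff.
have mE : measurable_fun (setT : set (borel X)) (fun x => (expR (t x * c'))%:E).
  exact: measurable_expR_tau.
pose g n := (fun x => (expR (t x * c'))%:E) \_ (V (n + m)%N).
have [_ _ h] : [/\ mu.-integrable setT (fun=> 0%E : \bar R),
    (\int[mu]_x `|g n x - 0| @[n --> \oo] --> 0)%E &
    (\int[mu]_x g n x @[n --> \oo] --> \int[mu]_x 0)%E].
  apply: (@dominated_convergence _ _ _ mu _ measurableT g _
    ((fun x => (expR (t x * c'))%:E) \_ (~` K))).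
  - by move=> n; apply/(measurable_restrictT _ (mV _)); exact: measurable_funTS.
  - by [].
  - apply: aeW => x _; apply: cvg_near_cst.
    have [k _ fk] := cvgr_lt _ (f0 x) _ e0.
    exists k => // n /= kn; rewrite /g patchE memNset// /V/=.
    apply/negP; rewrite -leNgt ltW//; apply: (fk (n + m)%N).
    by rewrite /= (leq_trans kn)// leq_addr.
  - apply/integrableP; split; first by apply/(measurable_restrictT _ mK); exact: measurable_funTS.
    under eq_integral => x _.
      rewrite gee0_abs; last by apply: erestrict_ge0 => y _; rewrite lee_fin expR_ge0.
      over.
    by rewrite -integral_mkcond.
  - apply: aeW => x n _; rewrite gee0_abs; last first.
      by apply: erestrict_ge0 => y _; rewrite lee_fin expR_ge0.
    rewrite /g !patchE; case: ifPn => xV; last by case: ifPn => // _; rewrite lee_fin expR_ge0.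
    rewrite mem_set//= => Kx; move: xV; rewrite inE /V/=; apply/negP; rewrite -leNgt.
    by rewrite (le_trans _ (ltW (fm _ Kx)))// ndf// leq_addl.
rewrite integral0 in h.
have h0 : (0 < (2^-1 : R)%:E)%E by rewrite lte_fin.
have [n _ hn] := cvge_lt _ h h0; exists (n + m)%N.
by rewrite integral_mkcond; exact: (hn n (leqnn n)).
Qed.

Lemma compact_rate_functional (M : R) : 0 < M -> compact [set nu | (rate nu <= M%:E)%E].
Proof.
move=> M0; apply: narrow_compact; first exact: closed_rate_functional.
move=> f Cf ndf f0 e e0.
have cf n : continuous (f n) by case: (Cf n).
have [C fC] : exists C, forall x, `|f 0%N x| <= C by case: (Cf 0%N).
pose B := Num.max C 1; have B0 : 0 < B by rewrite lt_max ltr01 orbT.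
have fB n x : f n x <= B.
  rewrite le_max (le_trans (ndf x _ _ (leq0n n)))//.
  by rewrite (le_trans (ler_norm _)).
have [b [b0 ib]] := exp_moment_vanishing.
pose d := e / 2; have d0 : 0 < d by rewrite divr_gt0.
have d20 : 0 < d / 2 by rewrite divr_gt0.
(* Testing with c phi - b gives nu(phi) <= (M + b) / c, while f n <= d + B phi. This lower bound on
   [c] makes B nu(phi) <= d, hence nu(f n) <= 2 d = e. *)
have [c [Mc c0 [n ic]]] := tail_exp_moment ((M + b) * B / d) cf ndf f0 d20.
have cpos : 0 < c by apply: le_lt_trans Mc; rewrite divr_ge0 ?mulr_ge0 ?addr_ge0// ltW.
exists n => nu Inu.
(* [phi] is 1 on [{d <= f n}] and vanishes off [{d / 2 < f n}]. *)
pose phi x := Num.min 1 (Num.max 0 (2 / d * f n x + - 1)).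
have cphi : continuous phi.
  apply: continuous_minr; first by move=> x; exact: cvg_cst.
  apply: continuous_maxr; first by move=> x; exact: cvg_cst.
  by apply: continuous_addr; [exact: continuous_scale|move=> x; exact: cvg_cst].
have phi01 x : 0 <= phi x <= 1 by rewrite le_min ler01 le_max lexx/= ge_min lexx.
have Cphi := Cb_itv01 cphi phi01.
have fphi x : f n x <= d + B * phi x.
  have [fd|fd] := leP (f n x) d.
    by rewrite (le_trans fd)// lerDl mulr_ge0// ?(ltW B0)//; case/andP: (phi01 x).
  rewrite /phi min_l; first by rewrite mulr1 (le_trans (fB n x))// lerDr ltW.
  rewrite le_max; apply/orP; right.
  have : 2 / d * d <= 2 / d * f n x by rewrite ler_wpM2l ?divr_ge0// ltW.
  by rewrite divfK ?gt_eqF//; lra.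
have phi0 x : ~ (d / 2 < f n x) -> phi x = 0.
  move=> /negP; rewrite -leNgt => fd; rewrite /phi max_l ?min_r//.
  have : 2 / d * f n x <= 2 / d * (d / 2) by rewrite ler_wpM2l ?divr_ge0// ltW.
  have -> : 2 / d * (d / 2) = 1 by field; rewrite gt_eqF.
  by lra.
have Cg : Cb (fun x => c * phi x + - b * 1).
  by apply: CbD; [exact: CbZ|exact/CbZ/Cb_cst].
have mV : measurable ([set x | d / 2 < f n x] : set (borel X)).
  apply: open_borel; rewrite (_ : mkset _ = f n @^-1` [set r | d / 2 < r])//.
  by move/continuousP: (cf n); apply; exact: open_gt.
have mE r : measurable_fun (setT : set (borel X)) (fun x => (expR (t x * r))%:E).
  exact: measurable_expR_tau.
have mEV : measurable_fun (setT : set (borel X))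
    ((fun x => (expR (t x * c))%:E) \_ [set x | d / 2 < f n x]).
  by apply/(measurable_restrictT _ mV); exact: measurable_funTS.
(* Off the set where [f n > d / 2] the exponential is e^(-b t); on it, phi <= 1 bounds it by e^(c
   t). Each contributes less than 1/2. *)
have tg : test_fun mu tau (fun x => c * phi x + - b * 1).
  split => //; have [cg _] := Cg.
  apply: (@le_trans _ _ (\int[mu]_x ((expR (t x * - b))%:E +
      ((fun x => (expR (t x * c))%:E) \_ [set x | (d / 2 < f n x)%R]) x)))%E.
    apply: ge0_le_integral => //.
    - by apply: measurable_expR_tau => //; exact: continuous_borel.
    - exact: emeasurable_funD.
    move=> x _; rewrite patchE; case: ifPn => xV.
      rewrite -EFinD lee_fin (@le_trans _ _ (expR (t x * c)))//; last by rewrite lerDr expR_ge0.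
      rewrite ler_expR ler_wpM2l//; have /andP[_ p1] := phi01 x.
      have : c * phi x <= c by rewrite ler_piMr.
      by lra.
    rewrite adde0 lee_fin phi0 ?mulr0 ?add0r ?mulr1//.
    by move=> h; move: xV; rewrite mem_set.
  rewrite ge0_integralD//; last first.
    by move=> x _; apply: erestrict_ge0 => y _; rewrite lee_fin expR_ge0.
  rewrite -integral_mkcond (le_trans (leeD (ltW ib) (ltW ic)))//.
  by rewrite -EFinD lee_fin; lra.
have := (rate_functional_leP nu M).1 Inu _ tg.
have iCb := fun f Cf => @Cb_integrable R X nu f Cf.
have C1 : @Cb R X (fun=> 1) by exact: Cb_cst.
have int1 : Rintegral nu setT (fun=> 1) = 1.
  by rewrite (Rintegral_cst _ measurableT) mul1r (congr1 fine (probability_setT nu)).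
rewrite RintegralD//; [|exact/iCb/CbZ|exact/iCb/CbZ].
rewrite (RintegralZl _ measurableT (iCb _ Cphi)) (RintegralZl _ measurableT (iCb _ C1)) int1.
set p := Rintegral nu setT phi => cpM.
apply: (@le_trans _ _ (d + B * p)); last first.
  have : B * p <= d.
    have pM : p <= (M + b) / c by rewrite ler_pdivlMr// mulrC; lra.
    apply: (le_trans (ler_wpM2l (ltW B0) pM)).
    move: Mc; rewrite ltr_pdivrMr// => Mc.
    by rewrite mulrA ler_pdivrMr// mulrC (mulrC d) ltW.
  by rewrite /d; lra.
have -> : d + B * p = Rintegral nu setT (fun x => d * 1 + B * phi x).
  rewrite RintegralD//; [|exact/iCb/CbZ|exact/iCb/CbZ].
  by rewrite (RintegralZl _ measurableT (iCb _ Cphi))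
    (RintegralZl _ measurableT (iCb _ C1)) int1 mulr1.
apply: le_Rintegral => //; first exact: iCb.
  by apply: iCb; apply: CbD; exact: CbZ.
by move=> x _; rewrite mulr1.
Qed.

(** The witness has density min(t, 1) / z with respect to [mu]: the factor t compensates 1/tau, and
    the cap at 1 makes the mass finite. Its rate is bounded through the test functions, without
    computing an entropy: where f > 0, min(t, 1) f <= t f <= e^(t f), so nu(f) <= 1/z. *)
Lemma rate_functional_proper : exists nu, (rate nu < +oo)%E.
Proof.
pose g x : R := Num.min (t x) 1.
have g0 x : 0 <= g x by rewrite le_min t0 ler01.
have mg : measurable_fun setT (EFin \o g).
  by apply/measurable_EFinP; exact: measurable_minr.
have ge0 x : (0 <= (EFin \o g) x)%E by rewrite lee_fin.
pose m : {measure set (borel X) -> \bar R} := mdensity mu mg ge0.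
pose z := (\int[mu]_x (EFin \o g) x)%E.
have zm : m setT = z by [].
have z_le1 : (z <= 1)%E.
  apply: (@le_trans _ _ (\int[mu]_x (cst 1%E x))%E).
    by apply: ge0_le_integral => // x _; rewrite lee_fin ge_min lexx orbT.
  by rewrite integral_cst// mul1e; exact: probability_le1.
have z_fin : z \is a fin_num.
  by rewrite ge0_fin_numE ?(le_lt_trans z_le1) ?ltry// integral_ge0.
(* If [z] were 0, min(t, 1) would vanish almost everywhere, whereas t > 0 almost everywhere: two
   null sets would cover the space. *)
have z_neq0 : z != 0%E.
  apply/eqP => zz; have := (ae_eq_integral_abs mu measurableT mg).1.
  move=> /(_ _)[|N [mN muN gN]].
    by under eq_integral do rewrite gee0_abs//.
  have [N' [mN' muN' tN']] := ae_rtau mtau tau_ge0 tau_neq0 tau_neqy.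
  have NT : N `|` N' = setT.
    apply/seteqP; split => // x _; apply: contrapT => /not_orP[Nx N'x].
    have [_ tx] : tau x = (t x)%:E /\ 0 < t x by apply: contrapT => /tN'.
    apply: Nx; apply: gN => /= /(_ I) -[]; apply/eqP; rewrite gt_eqF//.
    by rewrite lt_min tx ltr01.
  have := probability_setT mu; rewrite -NT null_set_setU//.
  by move/eqP; rewrite eq_sym onee_eq0.
have fz0 : 0 < fine z.
  apply: fine_gt0; apply/andP; split; last by rewrite (le_lt_trans z_le1)// ltry.
  by rewrite lt0e z_neq0; apply: integral_ge0.
pose nu : probability (borel X) R := mnormalize m mu.
exists nu; apply: (@le_lt_trans _ _ ((fine z)^-1)%:E); last exact: ltry.
apply/rate_functional_leP => f [[cf [C fC]] itf].
have mf := continuous_borel cf.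
have [a [b [aE bE ->]]] := Rintegral_pos_neg nu mf fC.
have b0 : 0 <= b.
  by rewrite -lee_fin -bE; apply: integral_ge0 => x _; rewrite lee_fin le_max lexx orbT.
rewrite lerBlDr (@le_trans _ _ (fine z)^-1)//; last by rewrite lerDl.
have mp : measurable_fun setT (fun x : borel X => (Num.max (f x) 0)%:E).
  by apply/measurable_EFinP; exact: measurable_maxr.
rewrite -lee_fin -aE (@integral_density _ _ _ nu mu (fun x => (fine z)^-1 * g x))//.
- apply: (@le_trans _ _ (\int[mu]_x (((fine z)^-1)%:E * (expR (t x * f x))%:E))%E).
    apply: ge0_le_integral => //.
    + by move=> x _; rewrite -EFinM lee_fin !mulr_ge0 ?invr_ge0 ?(ltW fz0)// le_max lexx orbT.
    + apply: emeasurable_funM => //; apply/measurable_EFinP.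
      by apply: measurable_funM => //; exact: measurable_minr.
    + by apply: emeasurable_funM => //; exact: measurable_expR_tau.
    move=> x _; rewrite -!EFinM lee_fin mulrCA ler_pM2l ?invr_gt0//.
    have [fx|fx] := leP (f x) 0; first by rewrite mul0r expR_ge0.
    apply: (@le_trans _ _ (f x * t x)); first by rewrite ler_pM2l// ge_min lexx.
    by rewrite mulrC; have := @expR_ge1Dx _ (t x * f x); lra.
  rewrite ge0_integralZl//; [|exact: measurable_expR_tau|by rewrite lee_fin invr_ge0 ltW].
  rewrite -[leRHS]mule1 lee_pmul2l// lte_fin invr_gt0//.
- by apply: measurable_funM => //; exact: measurable_minr.
- by move=> x; rewrite mulr_ge0// invr_ge0 ltW.
- move=> A mA.
  rewrite [LHS](_ : _ = m A * ((fine z)^-1)%:E)%E; last first.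
    by rewrite /nu /= /mnormalize [in X in X _](zm : _ = _)/= (negbTE z_neq0)/=
      lt_eqF// (le_lt_trans z_le1)// ltry.
  rewrite muleC -ge0_integralZl//.
  + by apply: measurable_funTS.
  + by rewrite lee_fin invr_ge0 ltW.
- by move=> x; rewrite lee_fin le_max lexx orbT.
Qed.

End goodness.

Local Open Scope ereal_scope.

Theorem proposition1p2 (R : realType) (X : polishMetricType R)
  (mu : probability (borel X) R) (tau : X -> \bar R)
  (mtau : measurable_fun (setT : set (borel X)) tau)
  (tau_ge0 : forall x, 0 <= tau x)
  (tau_neq0 : mu [set x | tau x = 0] = 0)
  (tau_neqy : mu [set x | tau x = +oo] = 0)
  (xi_eqy : mu [set x | xi mu tau x < +oo] = 0)
  (xi_infty_eqy : xi_infty mu tau = +oo) :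
  good_functional (rate_functional mu mtau tau_ge0) /\
  convex_functional (rate_functional mu mtau tau_ge0).
Proof.
split; last exact: convex_rate_functional.
split=> [nu|M M0|Ioo]; first exact: rate_functional_ge0.
  exact: compact_rate_functional.
have [nu] := rate_functional_proper mtau tau_ge0 tau_neq0 tau_neqy xi_eqy.
by rewrite Ioo.
Qed.
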